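(* Let $n\ge 5$ and $1\le k\le n-1$ be integers and let $G\in\mathscr{Q}(n,k)$ with $G\not\cong Q_{n,k}$. Then: (a) if $k\in\{1,2,3,n-1\}$, then $SO(G)\le \phi'(n,k)$, with equality if and only if $G\cong Q'_{n,k}$; (b) if $4\le k\le n-2$ and $n\ge 23$, then $SO(G)\le \phi^*(n,k)$, with equality if and only if $G\cong Q^*_{n,k}$.
   Context: All graphs are finite, simple and undirected; $d_G(v)$ is the degree of $v$ in $G$, and an $i$-vertex is a vertex of degree $i$. The Sombor index is $SO(G)=\sum_{uv\in E(G)}\sqrt{d_G(u)^2+d_G(v)^2}$. A connected graph $G$ is a quasi-tree if there is $u\in V(G)$ such that $G-u$ is a tree. $\mathscr{Q}(n,k)$ is the set of quasi-tree graphs $G$ of order $n$ having a vertex $u$ such that $G-u$ is a tree and $d_G(u)=k$. ''Attaching an isolated vertex to'' certain vertices means adding a new vertex and joining it by an edge to each of those vertices. Graphs: $S_m\cong K_{1,m-1}$ is the star of order $m$. $S'_n$ is obtained from $S_{n-1}$ by attaching an isolated vertex to one leaf. $Q_{n,k}$ is obtained from $S_{n-1}$ and a new vertex $v$ by joining $v$ to the center of $S_{n-1}$ and to $k-1$ leaves of $S_{n-1}$. $Q^*_{n,k}$ ($1\le k\le n-2$) is obtained from $S_{n-1}$ and a new vertex $v$ by joining $v$ to $k$ leaves of $S_{n-1}$ (and not to the center). $Q'_{n,1}\cong S'_n$; $Q'_{n,2}$ is obtained from $Q_{n-1,2}$ by attaching an isolated vertex to one $2$-vertex of $Q_{n-1,2}$;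 for $3\le k\le n-1$, $Q'_{n,k}$ is obtained from $Q_{n-1,k-1}$ by attaching an isolated vertex to one $2$-vertex and to the $(k-1)$-vertex $v$ (the vertex added to the star in the construction of $Q_{n-1,k-1}$). Functions: $\phi'(n,1)=(n-3)\sqrt{(n-2)^2+1}+\sqrt{(n-2)^2+4}+\sqrt5$; $\phi'(n,2)=(n-4)\sqrt{(n-2)^2+1}+\sqrt{(n-2)^2+4}+\sqrt{(n-2)^2+9}+\sqrt{13}+\sqrt{10}$; for $3\le k\le n-1$, $\phi'(n,k)=(k-2)\sqrt{k^2+4}+(k-3)\sqrt{(n-2)^2+4}+(n-k-1)\sqrt{(n-2)^2+1}+\sqrt{k^2+(n-2)^2}+\sqrt{(n-2)^2+9}+\sqrt{k^2+9}+\sqrt{13}$; for $1\le k\le n-2$, $\phi^*(n,k)=k\left(\sqrt{k^2+4}+\sqrt{(n-2)^2+4}\right)+(n-k-2)\sqrt{(n-2)^2+1}$. *)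

(* Defs.v *)
From mathcomp Require Import all_boot all_order all_algebra.
From mathcomp Require Import reals.
Set Implicit Arguments.
Unset Strict Implicit.
Unset Printing Implicit Defensive.
Import Order.TTheory GRing.Theory Num.Theory.

Record sgraph := SGraph {
  vert :> finType;
  adj : rel vert;
  adj_sym : symmetric adj;
  adj_irr : irreflexive adj
}.

Definition deg (G : sgraph) (v : G) : nat := #|[set w | adj v w]|.

Definition edges (G : sgraph) : {set {set G}} :=
  [set [set p.1; p.2] | p : G * G & adj p.1 p.2].

Definition giso (G H : sgraph) : Prop :=
  exists2 f : G -> H, bijective f & forall x y, adj (f x) (f y) = adj x y.

Definition gconnected (G : sgraph) : Prop :=
  0 < #|G| /\ forall x y : G, connect (@adj G) x y.

(* The bound on the size is needed because [ucycle] also accepts [::] and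
   [:: x; y] with x, y adjacent, which are not cycles of a simple graph. *)
Definition acyclic (G : sgraph) : Prop :=
  forall c : seq G, ucycle (@adj G) c -> size c < 3.

Definition is_tree (G : sgraph) : Prop := gconnected G /\ acyclic G.

Section DeleteVertex.
Variables (G : sgraph) (u : G).

Definition del_adj : rel {x : G | x != u} := fun x y => adj (val x) (val y).

Lemma del_adj_sym : symmetric del_adj.
Proof. by move=> x y; apply: adj_sym. Qed.

Lemma del_adj_irr : irreflexive del_adj.
Proof. by move=> x; apply: adj_irr. Qed.

Definition del_vertex : sgraph := SGraph del_adj_sym del_adj_irr.
End DeleteVertex.

Definition quasi_tree (G : sgraph) : Prop :=
  gconnected G /\ exists u : G, is_tree (del_vertex u).

Definition quasi_tree_class (n k : nat) (G : sgraph) : Prop :=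
  [/\ quasi_tree G, #|G| = n
    & exists u : G, is_tree (del_vertex u) /\ deg u = k].

Section Attach.
Variables (G : sgraph) (A : {set G}).

Definition attach_adj : rel (option G) := fun x y =>
  match x, y with
  | Some a, Some b => adj a b
  | Some a, None | None, Some a => a \in A
  | None, None => false
  end.

Lemma attach_adj_sym : symmetric attach_adj.
Proof. by move=> [a|] [b|] //=; apply: adj_sym. Qed.

Lemma attach_adj_irr : irreflexive attach_adj.
Proof. by move=> [a|] //=; apply: adj_irr. Qed.

Definition attach : sgraph := SGraph attach_adj_sym attach_adj_irr.
End Attach.

Section Star.
Variable m : nat.

(* The center is 0 and the leaves are 1, ..., m - 1. *)
Definition star_adj : rel 'I_m := fun i j => (i == 0 :> nat) != (j == 0 :> nat).

Lemma star_adj_sym : symmetric star_adj.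
Proof. by move=> i j; rewrite /star_adj eq_sym. Qed.

Lemma star_adj_irr : irreflexive star_adj.
Proof. by move=> i; rewrite /star_adj eqxx. Qed.

Definition star : sgraph := SGraph star_adj_sym star_adj_irr.
End Star.

(* All leaves of a star are equivalent under automorphisms, so the k (or k - 1)
   leaves joined to the new vertex are taken to be the ones of smallest index.
   In [attach], the new vertex is [None]. *)
Definition Qgraph (n k : nat) : sgraph :=
  attach (G := star n.-1) [set i : 'I_n.-1 | i < k].

Definition Qstar (n k : nat) : sgraph :=
  attach (G := star n.-1) [set i : 'I_n.-1 | 0 < i <= k].

Definition Sprime (n : nat) : sgraph :=
  attach (G := star n.-1) [set i : 'I_n.-1 | i == 1 :> nat].

(* In [Qgraph n.-1 2] and [Qgraph n.-1 k.-1], leaf 1 of the star is adjacent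
   exactly to the center and to [None], hence is a 2-vertex. Any other 2-vertex
   (other than [None] itself, in the last case) gives an isomorphic graph. *)
Definition Qprime (n k : nat) : sgraph :=
  match k with
  | 1 => Sprime n
  | 2 => attach (G := Qgraph n.-1 2)
           [set x : option 'I_n.-2 | if x is Some i then i == 1 :> nat else false]
  | _ => attach (G := Qgraph n.-1 k.-1)
           [set x : option 'I_n.-2 | if x is Some i then i == 1 :> nat else true]
  end.

Local Open Scope ring_scope.

(* An edge is a 2-element set {u, v}, so the inner sum is d(u)^2 + d(v)^2. *)
Definition SO (R : realType) (G : sgraph) : R :=
  \sum_(e in edges G) Num.sqrt (\sum_(x in e) (deg x)%:R ^+ 2).

Definition phi' (R : realType) (n k : nat) : R :=
  let N : R := n%:R in
  let K : R := k%:R in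
  match k with
  | 1 => (N - 3) * Num.sqrt ((N - 2) ^+ 2 + 1) + Num.sqrt ((N - 2) ^+ 2 + 4)
         + Num.sqrt 5
  | 2 => (N - 4) * Num.sqrt ((N - 2) ^+ 2 + 1) + Num.sqrt ((N - 2) ^+ 2 + 4)
         + Num.sqrt ((N - 2) ^+ 2 + 9) + Num.sqrt 13 + Num.sqrt 10
  | _ => (K - 2) * Num.sqrt (K ^+ 2 + 4)
         + (K - 3) * Num.sqrt ((N - 2) ^+ 2 + 4)
         + (N - K - 1) * Num.sqrt ((N - 2) ^+ 2 + 1)
         + Num.sqrt (K ^+ 2 + (N - 2) ^+ 2) + Num.sqrt ((N - 2) ^+ 2 + 9)
         + Num.sqrt (K ^+ 2 + 9) + Num.sqrt 13
  end.

Definition phi_star (R : realType) (n k : nat) : R :=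
  let N : R := n%:R in
  let K : R := k%:R in
  K * (Num.sqrt (K ^+ 2 + 4) + Num.sqrt ((N - 2) ^+ 2 + 4))
  + (N - K - 2) * Num.sqrt ((N - 2) ^+ 2 + 1).

(* Main.v *)
Require Import Defs.
From mathcomp Require Import all_boot all_order all_algebra.
From mathcomp Require Import reals ring lra zify.
Set Implicit Arguments.
Unset Strict Implicit.
Unset Printing Implicit Defensive.
Import Order.TTheory GRing.Theory Num.Theory.

(** Write [T = G - u] and [N = n - 2], and let [A] be the neighbourhood of [u].
    If [T] is a star, then [G] is [Qgraph n k] or [Qstar n k], according to
    whether its center is in [A].  If the largest degree of [T] is [#|T| - 2],
    then [T] is a star with one subdivided edge, and [SO G] is an explicit
    function of the position of [A], maximal exactly for [Qprime n k] (up to a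
    symmetry of the path on four vertices).  Otherwise we show
    [SO G < phi' n k] by induction on [T].  Deleting a pendant vertex of [T]
    changes [SO] by at most a sum over its one or two neighbours, because
    [sqrt (x^2 + y^2)] is submodular; as all degrees in [T] are at most
    [#|T| - 3], this change is smaller than the corresponding increment of
    [phi'].  Part (b) follows from [phi' n k < phi_star n k]. *)

(** * The Euclidean norm on pairs *)

(** The induction may delete any pendant vertex: if all degrees of a tree are at most its order
    minus 3, then after the deletion they are at most the new order minus 2, and this is all that
    the non-strict bound asks for. Trees with a vertex of degree [#|T| - 2] thus serve as base
    cases, and among non-stars they are the only ones where equality has to be analysed.

    The increments to be compared are close to each other, so differences of square roots are
    replaced by rational bounds, obtained from a tangent and the inequality between the arithmetic
    and geometric means.

    Subtrees are vertex sets of the fixed graph [G], with degrees counted inside the set. Deleting a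
    vertex then changes neither the type of the graph nor the role of [u]. *)

Section Hypot.
Variable R : realType.
Implicit Types x y z : R.
Local Open Scope ring_scope.

Definition hypot x y : R := Num.sqrt (x ^+ 2 + y ^+ 2).
(** Change in the weight of an edge when one end rises to degree [x] and the other keeps degree
    [y]. *)
Definition hypotd x y : R := hypot x y - hypot (x - 1) y.

Lemma sumsq_ge0 x y : 0 <= x ^+ 2 + y ^+ 2.
Proof. by rewrite addr_ge0 ?sqr_ge0. Qed.

Lemma hypot_ge0 x y : 0 <= hypot x y.
Proof. exact: sqrtr_ge0. Qed.

Lemma sqr_hypot x y : hypot x y ^+ 2 = x ^+ 2 + y ^+ 2.
Proof. by rewrite sqr_sqrtr ?sumsq_ge0. Qed.

Lemma hypotC x y : hypot x y = hypot y x.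
Proof. by rewrite /hypot addrC. Qed.

Lemma le_hypot z x y : z ^+ 2 <= x ^+ 2 + y ^+ 2 -> z <= hypot x y.
Proof.
move=> le_z; have [z_lt0|z_ge0] := ltP z 0; first by apply: le_trans (hypot_ge0 _ _); lra.
by rewrite -(ler_pXn2r (n := 2)) ?nnegrE ?hypot_ge0 // sqr_hypot.
Qed.

Lemma hypot_le z x y : 0 <= z -> x ^+ 2 + y ^+ 2 <= z ^+ 2 -> hypot x y <= z.
Proof. by move=> z0 le_z; rewrite -(ler_pXn2r (n := 2)) ?nnegrE ?hypot_ge0 // sqr_hypot. Qed.

Lemma ltr_hypot x y x' y' :
  x ^+ 2 + y ^+ 2 < x' ^+ 2 + y' ^+ 2 -> hypot x y < hypot x' y'.
Proof. by move=> lt_s; rewrite -(ltr_pXn2r (n := 2)) ?nnegrE ?hypot_ge0 // !sqr_hypot. Qed.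

Lemma ler_hypot x y x' y' : 0 <= x <= x' -> 0 <= y <= y' -> hypot x y <= hypot x' y'.
Proof. by move=> hx hy; apply: hypot_le; rewrite ?hypot_ge0 // sqr_hypot; nra. Qed.

Lemma hypot_gel x y : x <= hypot x y.
Proof. by apply: le_hypot; rewrite lerDl sqr_ge0. Qed.

(** Both sides have the same sum of squared terms, so after squaring only the two products are
    compared. The squares of these differ by [(x' ^+ 2 - x ^+ 2) * (y' ^+ 2 - y ^+ 2)]. *)
Lemma hypot_submod x x' y y' : 0 <= x <= x' -> 0 <= y <= y' ->
  hypot x' y' + hypot x y <= hypot x' y + hypot x y'.
Proof.
move=> hx hy.
have h2 z z' t t' : (hypot z z' * hypot t t') ^+ 2
    = (z ^+ 2 + z' ^+ 2) * (t ^+ 2 + t' ^+ 2) by rewrite exprMn !sqr_hypot.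
have : hypot x' y' * hypot x y <= hypot x' y * hypot x y'.
  rewrite -(ler_pXn2r (n := 2)) ?nnegrE ?mulr_ge0 ?hypot_ge0 // !h2.
  have : 0 <= (x' ^+ 2 - x ^+ 2) * (y' ^+ 2 - y ^+ 2) by apply: mulr_ge0; nra.
  by nra.
move=> le_prod; rewrite -(ler_pXn2r (n := 2)) ?nnegrE ?addr_ge0 ?hypot_ge0 //.
have := (sqr_hypot x' y', sqr_hypot x y, sqr_hypot x' y, sqr_hypot x y').
by case=> [[[e1 e2] e3] e4]; rewrite !sqrrD e1 e2 e3 e4; lra.
Qed.

Lemma hypotd_le1 x y : 1 <= x -> hypotd x y <= 1.
Proof.
move=> x1; rewrite /hypotd lerBlDr; apply: hypot_le; first by rewrite addr_ge0 ?hypot_ge0.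
by have := hypot_gel (x - 1) y; have := sqr_hypot (x - 1) y; rewrite sqrrD; lra.
Qed.

Lemma hypotd_antitone x y y' : 1 <= x -> 0 <= y <= y' -> hypotd x y' <= hypotd x y.
Proof.
move=> x1 hy; have hx : 0 <= x - 1 <= x by lra.
by have := hypot_submod hx hy; rewrite /hypotd; lra.
Qed.

Lemma hypot_gt0 x y : 0 < x -> 0 < hypot x y.
Proof. by move=> x0; apply: lt_le_trans (hypot_gel _ _). Qed.

(* Cauchy-Schwarz against the unit vector at [(x, y)]. *)
Lemma hypot_diff_ge x y x' y' : 0 < x ->
  (x * (x' - x) + y * (y' - y)) / hypot x y <= hypot x' y' - hypot x y.
Proof.
move=> x0; rewrite ler_pdivrMr ?hypot_gt0 // mulrBl.
suff : x * x' + y * y' <= hypot x' y' * hypot x y.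
  by have := sqr_hypot x y; nra.
rewrite -[leRHS]ger0_norm ?mulr_ge0 ?hypot_ge0 //; apply: le_trans (ler_norm _) _.
rewrite -(ler_pXn2r (n := 2)) ?nnegrE // !real_normK ?num_real //.
rewrite exprMn !sqr_hypot -subr_ge0.
have -> : (x' ^+ 2 + y' ^+ 2) * (x ^+ 2 + y ^+ 2) - (x * x' + y * y') ^+ 2
   = (x * y' - y * x') ^+ 2 by ring.
exact: sqr_ge0.
Qed.

(** With [t = x - 1] and [r = hypot t y], the tangent at [(t, y)] gives the bound [t / r]. It is at
    least [2 * t ^+ 2 / (r ^+ 2 + t ^+ 2)] because [2 * t * r <= r ^+ 2 + t ^+ 2], and this is free
    of square roots. *)
Lemma hypotd_ge x y : 1 < x ->
  1 - y ^+ 2 / (2 * (x - 1) ^+ 2 + y ^+ 2) <= hypotd x y.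
Proof.
move=> x1; have x0 : 0 < x - 1 by lra.
apply: le_trans (hypot_diff_ge y x y x0).
have h0 := hypot_gt0 y x0; have hx := hypot_gel (x - 1) y; have hs := sqr_hypot (x - 1) y.
have -> : x - (x - 1) = 1 by ring.
set t := x - 1 in x0 h0 hx hs *; set r := hypot t y in h0 hx hs *.
have d0 : 0 < 2 * t ^+ 2 + y ^+ 2 by have := sqr_ge0 y; nra.
rewrite (_ : 1 - _ = 2 * t ^+ 2 / (2 * t ^+ 2 + y ^+ 2)); last by field; lra.
rewrite ler_pdivrMr // mulrAC ler_pdivlMr //.
rewrite mulr1 subrr mulr0 addr0.
have -> : 2 * t ^+ 2 + y ^+ 2 = r ^+ 2 + t ^+ 2 by lra.
have -> : t * (r ^+ 2 + t ^+ 2) = 2 * t ^+ 2 * r + t * (r - t) ^+ 2 by ring.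
by rewrite lerDl mulr_ge0 ?sqr_ge0 // ltW.
Qed.

(** Counterpart of [hypotd_ge]: the tangent is taken at [(x, y)], and [x / r] is bounded by
    [(r ^+ 2 + x ^+ 2) / (2 * r ^+ 2)]. *)
Lemma hypotd_le x y : 1 <= x -> hypotd x y <= 1 - y ^+ 2 / (2 * (x ^+ 2 + y ^+ 2)).
Proof.
move=> x1; have x0 : 0 < x by lra.
have : hypotd x y <= x / hypot x y.
  have := hypot_diff_ge y (x - 1) y x0; rewrite /hypotd.
  rewrite (_ : _ + _ = - x); last by ring.
  by rewrite mulNr; lra.
move/le_trans; apply.
have h0 := hypot_gt0 y x0; have hx := hypot_gel x y; have hs := sqr_hypot x y.
set r := hypot x y in h0 hx hs *; rewrite -hs.
rewrite (_ : 1 - _ = (r ^+ 2 + x ^+ 2) / (2 * r ^+ 2)); last first.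
  rewrite (_ : y ^+ 2 = r ^+ 2 - x ^+ 2); last by lra.
  by field; lra.
rewrite ler_pdivrMr // mulrAC ler_pdivlMr; last by nra.
by have := sqr_ge0 (r - x); nra.
Qed.

(** The two tangent bounds at the midpoint have opposite signs and cancel. *)
Lemma hypot_midconvex x y : 0 < x -> 2 * hypot x (y + 1) <= hypot x y + hypot x (y + 2).
Proof.
move=> x0; have := hypot_diff_ge (y + 1) x y x0; have := hypot_diff_ge (y + 1) x (y + 2) x0.
have -> : x * (x - x) + (y + 1) * (y + 2 - (y + 1)) = y + 1 by ring.
have -> : x * (x - x) + (y + 1) * (y - (y + 1)) = - (y + 1) by ring.
by rewrite mulNr; lra.
Qed.

End Hypot.

(** * Bounds on the extremal values *)

Section ExtremalValues.
Variable R : realType.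
Local Open Scope ring_scope.
Local Notation hypot := (@hypot R).
Local Notation hypotd := (@hypotd R).
Implicit Types (N K : R) (k : nat).

Definition phi1 N := (N - 1) * hypot N 1 + hypot N 2 + hypot 1 2.
Definition phi2 N := (N - 2) * hypot N 1 + hypot N 2 + hypot N 3 + hypot 3 2 + hypot 3 1.
Definition phi3 N K := (K - 2) * hypot K 2 + (K - 3) * hypot N 2
  + (N + 1 - K) * hypot N 1 + hypot K N + hypot N 3 + hypot K 3 + hypot 3 2.

(* [phi'] in terms of the degree [N = n - 2] of the center, extended
   to [k = 0], which occurs when the induction deletes the last vertex of [A]. *)
Definition phiQ N k :=
  match k with 0 | 1 => phi1 N | 2 => phi2 N | _ => phi3 N k%:R end.

Lemma phi'E n k : (0 < k)%N -> phi' R n k = phiQ (n%:R - 2) k.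
Proof.
have e4 : 4 = 2 ^+ 2 :> R by ring.
have e9 : 9 = 3 ^+ 2 :> R by ring.
have e5 : 5 = 1 ^+ 2 + 2 ^+ 2 :> R by ring.
have e10 : 10 = 3 ^+ 2 + 1 ^+ 2 :> R by ring.
have e13 : 13 = 3 ^+ 2 + 2 ^+ 2 :> R by ring.
have e1 (N : R) : N ^+ 2 + 1 = N ^+ 2 + 1 ^+ 2 by rewrite expr1n.
case: k => [|[|[|k]]] // _; rewrite /phi' /phiQ /phi1 /phi2 /phi3 -/(hypot _ _).
- by rewrite e1 e4 e5 -!/(hypot _ _); move: n%:R => N; ring.
- by rewrite e1 e4 e9 e10 e13 -!/(hypot _ _); move: n%:R => N; ring.
by rewrite e1 e4 e9 e13 -!/(hypot _ _); move: n%:R k.+3%:R => N K; ring.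
Qed.

(** The constants are the values at [N = 4], the worst case, of the bounds given by [hypotd_ge]. *)
Lemma hypotd_bounds N : 4 <= N ->
  [/\ hypotd N 2 <= hypotd N 1, hypotd N 3 <= hypotd N 2 <= 1,
      (N - 2) * (1 - hypotd N 2) <= 4 / 11,
      1 - hypotd N 2 <= 2 / 11 & 1 - hypotd N 3 <= 1 / 3].
Proof.
move=> N4; have N1 : 1 < N by lra.
have := hypotd_ge 2 N1; have := hypotd_ge 3 N1.
have e2 : 2 ^+ 2 / (2 * (N - 1) ^+ 2 + 2 ^+ 2) <= 2 / 11 :> R.
  by rewrite ler_pdivrMr; nra.
have e2' : (N - 2) * (2 ^+ 2 / (2 * (N - 1) ^+ 2 + 2 ^+ 2)) <= 4 / 11 :> R.
  by rewrite mulrA ler_pdivrMr; nra.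
have e3 : 3 ^+ 2 / (2 * (N - 1) ^+ 2 + 3 ^+ 2) <= 1 / 3 :> R.
  by rewrite ler_pdivrMr; nra.
move=> h3 h2; split; try lra.
- by apply: hypotd_antitone; lra.
- by rewrite hypotd_antitone ?hypotd_le1; lra.
have : (N - 2) * (1 - hypotd N 2) <= (N - 2) * (2 ^+ 2 / (2 * (N - 1) ^+ 2 + 2 ^+ 2)).
  by rewrite ler_wpM2l; lra.
by lra.
Qed.

(** The left side bounds the gain from a pendant vertex not adjacent to [u], whose tree neighbour
    reaches degree at most [N - 1]. On the right, for [3 <= k], the [N - 2] differences [hypotd N 1]
    and [hypotd N 2] fall short of 1 by at most 4/11 in total, and the extra [hypotd N 3] is at
    least 2/3. *)
Lemma phiQ_step N k : 4 <= N -> k%:R <= N ->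
  hypot (N - 1) 1 + (N - 2) < phiQ N k - phiQ (N - 1) k.
Proof.
move=> N4 kN; have [d21 /andP[d32 d2] e2 e2' e3] := hypotd_bounds N4.
have h1 : phi1 N - phi1 (N - 1) = hypot (N - 1) 1 + (N - 1) * hypotd N 1 + hypotd N 2.
  by rewrite /phi1 /hypotd; ring.
have m1 : (N - 2) * hypotd N 2 <= (N - 2) * hypotd N 1 by rewrite ler_wpM2l; lra.
case: k kN => [|[|[|k]]] kN; rewrite /phiQ; try by rewrite h1; lra.
  have -> : phi2 N - phi2 (N - 1)
     = hypot (N - 1) 1 + (N - 2) * hypotd N 1 + hypotd N 2 + hypotd N 3.
    by rewrite /phi2 /hypotd; ring.
  by lra.
set K : R := k.+3%:R in kN *.
have K3 : 3 <= K by rewrite /K ler_nat.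
have -> : phi3 N K - phi3 (N - 1) K = hypot (N - 1) 1 + (N + 1 - K) * hypotd N 1
     + (K - 3) * hypotd N 2 + hypotd N 3 + hypotd N K.
  by rewrite /phi3 /hypotd !(hypotC K); ring.
have : 0 <= hypotd N K by rewrite /hypotd subr_ge0 ler_hypot //; lra.
have : (N + 1 - K) * hypotd N 2 <= (N + 1 - K) * hypotd N 1 by rewrite ler_wpM2l; lra.
by lra.
Qed.

(** Case of a pendant vertex that is the only neighbour of [u]. Since [phiQ] agrees at 0 and 1,
    nothing on the right accounts for the new edge at [u], of weight [hypot 1 2]. In return the tree
    neighbour is not adjacent to [u] and has degree at most [N - 2]. *)
Lemma phi1_step N : 4 <= N ->
  hypot (N - 2) 2 + (N - 3) + hypot 1 2 < phi1 N - phi1 (N - 1).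
Proof.
move=> N4; have [d21 /andP[d32 d2] e2 e2' e3] := hypotd_bounds N4.
have -> : phi1 N - phi1 (N - 1) = hypot (N - 1) 1 + (N - 1) * hypotd N 1 + hypotd N 2.
  by rewrite /phi1 /hypotd; ring.
have m1 : (N - 2) * hypotd N 2 <= (N - 2) * hypotd N 1 by rewrite ler_wpM2l; lra.
have : hypot (N - 2) 2 <= N - 11 / 10 by apply: hypot_le; nra.
have : hypot 1 2 <= 9 / 4 :> R by apply: hypot_le; lra.
have := hypot_gel (N - 1) 1.
by lra.
Qed.

(** Case of a pendant vertex adjacent to [u], which has [k] other neighbours. The last two terms on
    the left are the gain at [u], the first two the gain at the tree neighbour. *)
Lemma phiQS_step N k : 4 <= N -> (0 < k)%N -> k%:R <= N ->
  hypot (N - 1) 2 + (N - 2) + hypot k.+1%:R 2 + k%:R * hypotd k.+1%:R 2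
    < phiQ N k.+1 - phiQ (N - 1) k.
Proof.
move=> N4 k0 kN; have [d21 /andP[d32 d2] e2 e2' e3] := hypotd_bounds N4.
have m1 : (N - 2) * hypotd N 2 <= (N - 2) * hypotd N 1 by rewrite ler_wpM2l; lra.
have := hypot_gel N 3; have := hypot_gel N 1; have := hypot_gel (N - 1) 1.
case: k k0 kN => [|[|[|k]]] // _ kN; rewrite /phiQ => f3 f2 f1.
- have -> : phi2 N - phi1 (N - 1)
    = (N - 2) * hypotd N 1 + hypotd N 2 + hypot N 3 + hypot 3 2 + hypot 3 1 - hypot 1 2.
    by rewrite /phi1 /phi2 /hypotd; ring.
  have : hypotd 2 2 <= 1 by apply: hypotd_le1; lra.
  have : hypot 2 2 <= 3 :> R by apply: hypot_le; lra.
  have : 3 <= hypot 3 1 :> R by apply: hypot_gel.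
  have : 3 <= hypot 3 2 :> R by apply: hypot_gel.
  have : hypot 1 2 <= 9 / 4 :> R by apply: hypot_le; lra.
  have : hypot (N - 1) 2 <= N by apply: hypot_le; nra.
  by rewrite mul1r; lra.
- have -> : phi3 N 3 - phi2 (N - 1)
    = hypot 3 2 + hypot 3 3 - hypot 3 1 + (N - 3) * hypotd N 1 + hypot N 1
     + hypotd N 3 + hypot N 3 - hypot (N - 1) 2.
    by rewrite /phi3 /phi2 /hypotd (hypotC 3 N); ring.
  have -> : hypotd 3 2 = hypot 3 2 - hypot 2 2 by rewrite /hypotd; congr (_ - hypot _ _); ring.
  have : hypot 3 2 <= 361 / 100 :> R by apply: hypot_le; lra.
  have : 282 / 100 <= hypot 2 2 :> R by apply: le_hypot; lra.
  have : hypot 3 1 <= 317 / 100 :> R by apply: hypot_le; lra.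
  have : 424 / 100 <= hypot 3 3 :> R by apply: le_hypot; lra.
  have hN2 : hypot (N - 1) 2 <= N - 39 / 100 by apply: hypot_le; nra.
  have : hypot (N - 1) 2 + 1 <= hypot N 3.
    by apply: le_hypot; rewrite sqrrD sqr_hypot; lra.
  have : hypotd N 1 <= 1 by apply: hypotd_le1; lra.
  by lra.
set K : R := k.+4%:R; have {}kN : K <= N + 1 by rewrite /K -natr1; lra.
have -> : k.+3%:R = K - 1 by rewrite /K -[k.+4%:R]natr1 addrK.
have K4 : 4 <= K by rewrite /K ler_nat.
have -> : phi3 N K - phi3 (N - 1) (K - 1) = hypot (N - 1) 2 + hypot K 2 + (K - 3) * hypotd N 2
    + hypotd N 3 + (N + 1 - K) * hypotd N 1 + (hypot K N - hypot (K - 1) (N - 1))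
    + hypotd K 3 + (K - 3) * hypotd K 2.
  by rewrite /phi3 /hypotd; ring.
have : (N + 1 - K) * hypotd N 2 <= (N + 1 - K) * hypotd N 1 by rewrite ler_wpM2l; lra.
have K1 : 1 < K by lra.
(* The tangent at [(K - 1, N - 1)] in the diagonal direction has slope
   [(K - 1 + N - 1) / hypot (K - 1) (N - 1)], which is at least 1. *)
have : 1 <= hypot K N - hypot (K - 1) (N - 1).
  have K0 : 0 < K - 1 by lra.
  apply: le_trans (hypot_diff_ge (N - 1) K N K0).
  rewrite ler_pdivlMr ?hypot_gt0 // mul1r; apply: hypot_le; nra.
have : hypotd K 2 <= 1 by apply: hypotd_le1; lra.
(* The available slack is 2/3 - 4/11, which exceeds 3/10 by only 1/330. *)
have : hypotd K 2 - hypotd K 3 < 3 / 10.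
  have := hypotd_le 2 (ltW K1); have := hypotd_ge 3 K1.
  (* For [5 <= K] it is enough that [hypotd K 2 <= 1]; at [K = 4] this would leave 1/3, so the
     sharper bound 9/10 is used. *)
  have [K5 | K5] : K = 4 \/ 5 <= K.
    case: (k) @K {kN K4 K1} => [|j] /=; first by left.
    by right; rewrite ler_nat.
  - have -> : 3 ^+ 2 / (2 * (K - 1) ^+ 2 + 3 ^+ 2) = 1 / 3 by rewrite K5; field.
    have -> : 2 ^+ 2 / (2 * (K ^+ 2 + 2 ^+ 2)) = 1 / 10 by rewrite K5; field.
    by lra.
  have : 3 ^+ 2 / (2 * (K - 1) ^+ 2 + 3 ^+ 2) <= 9 / 41 :> R.
    by rewrite ler_pdivrMr; nra.
  have : 0 <= 2 ^+ 2 / (2 * (K ^+ 2 + 2 ^+ 2)).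
    by apply: divr_ge0; nra.
  by lra.
by lra.
Qed.

End ExtremalValues.

(** * Values for a star with one subdivided edge *)

Section NearStarValues.
Variable R : realType.
Local Open Scope ring_scope.
Local Notation hypot := (@hypot R).
Local Notation hypotd := (@hypotd R).
Implicit Types (N K : R) (a b c : bool) (k l : nat).

(* The Sombor index when [T] is a star with one subdivided edge: [a], [b] and
   [c] tell whether the center, the vertex of degree 2 and its pendant neighbour
   are in [A], [L] is the number of other leaves in [A], and [K = #|A|]. *)
Definition sigma N a b c (L K : R) : R :=
  let C := if a then N else N - 1 in
  let W := if b then 3 else 2 in
  L * (hypot C 2 + hypot K 2) + (N - 2 - L) * hypot C 1
  + hypot C W + hypot W (if c then 2 else 1)
  + (if a then hypot K N else 0) + (if b then hypot K 3 else 0) + (if c then hypot K 2 else 0).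

Lemma hypot_bounds : [/\ 36 / 10 <= hypot 3 2, hypot 2 2 <= 283 / 100,
  316 / 100 <= hypot 3 1 <= 317 / 100 & 22 / 10 <= hypot 1 2 <= 9 / 4].
Proof. by split; try (apply/andP; split); first [apply: le_hypot | apply: hypot_le]; lra. Qed.

(** Exchanging a leaf in [A] for the center keeps [K] and raises the degree of the center. The loss
    of degree at that leaf is outweighed, as [hypot (N - 1) 2 < hypot N 1]. *)
Lemma sigma_lt_swap N b c L K : 3 <= N -> 0 <= L <= N - 3 -> 0 <= K ->
  sigma N false b c (L + 1) K < sigma N true b c L K.
Proof.
move=> N3 hL K0; rewrite /sigma; set W : R := if b then 3 else 2.
have W0 : 0 <= W by rewrite /W; case: (b).
have : hypot (N - 1) 2 < hypot N 1 by apply: ltr_hypot; nra.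
have : hypot K 2 <= hypot K N by apply: ler_hypot; lra.
have d y : 0 <= y -> 0 <= hypotd N y by move=> ?; rewrite subr_ge0 ler_hypot //; lra.
have : 0 <= hypotd N W by apply: d.
have : 0 <= L * hypotd N 2 by rewrite mulr_ge0 ?d; lra.
have : 0 <= (N - 3 - L) * hypotd N 1 by rewrite mulr_ge0 ?d; lra.
by rewrite /hypotd; case: (b) (c) => [] []; lra.
Qed.

(** [u] is joined to the center first, then to the vertex of degree 2, then to its pendant
    neighbour, and only then to other leaves. This is the position of [A] in [Qprime]. *)
Definition canonical a b c k := [&& a, b == (1 < k)%N & c == (2 < k)%N].

Lemma sigma_canonical N a b c l k : k = (a + b + c + l)%N -> (0 < k)%N ->
  canonical a b c k -> sigma N a b c l%:R k%:R = phiQ N k.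
Proof.
move=> ek k0 /and3P[ea /eqP eb /eqP ec]; rewrite {}ea {a} in ek *.
case: k k0 eb ec ek => [|[|[|k]]] //= _ -> -> ek; rewrite /phiQ /sigma /=.
- have -> : l = 0%N by lia.
  by rewrite /phi1 (hypotC 1 N) (hypotC 2 1); ring.
- have -> : l = 0%N by lia.
  by rewrite /phi2 (hypotC 2 N) (hypotC 2 3); ring.
have -> : l%:R = k.+3%:R - 3 :> R by rewrite (_ : k.+3 = l + 3)%N ?natrD ?addrK //; lia.
by move: k.+3%:R => K; rewrite /phi3; ring.
Qed.

Lemma sigma_true_lt N b c l k : N = 3 \/ 4 <= N -> l%:R <= N - 2 ->
    k = (1 + b + c + l)%N -> ~~ canonical true b c k ->
  sigma N true b c l%:R k%:R <= phiQ N k /\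
  (sigma N true b c l%:R k%:R = phiQ N k -> [/\ N = 3, b, ~~ c & l = 1%N]).
Proof.
move=> N34 lN ek nc; have N3 : 3 <= N by lra.
have [e32 e22 /andP[e31 e31'] /andP[e12 e12']] := hypot_bounds.
have N0 : 0 < N by lra.
have mc : 2 * hypot N 2 <= hypot N 1 + hypot N 3.
  by have := hypot_midconvex 1 N0; have -> : 1 + 2 = 3 :> R by ring.
have cmp : hypot N 2 - hypot N 1 <= hypot 3 2 - hypot 3 1.
  have : hypot N 2 + hypot 3 1 <= hypot N 1 + hypot 3 2 by apply: hypot_submod; lra.
  by lra.
have f23 : hypot N 2 < hypot N 3 by apply: ltr_hypot; lra.
have g23 : hypot k%:R 2 < hypot k%:R 3 by apply: ltr_hypot; lra.
have strict : sigma N true b c l%:R k%:R < phiQ N k ->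
  sigma N true b c l%:R k%:R <= phiQ N k /\
  (sigma N true b c l%:R k%:R = phiQ N k -> [/\ N = 3, b, ~~ c & l = 1%N]).
  by move=> lt; split; [apply: ltW | move=> e; rewrite e ltxx in lt].
have e3 m : m.+3%:R = m%:R + 3 :> R by rewrite -natrD addn3.
have e2 m : m.+2%:R = m%:R + 2 :> R by rewrite -natrD addn2.
rewrite -subr_gt0 in strict; case: b c ek nc strict => [] [] /= ek nc strict.
- by rewrite ek /canonical in nc.
- case: l lN ek strict => [|l] lN ek strict; first by rewrite ek in nc.
  have {}ek : k = l.+3 by rewrite ek.
  have eq : phiQ N k - sigma N true true false l.+1%:R k%:R
     = hypot N 1 - hypot N 2 + hypot 3 2 - hypot 3 1.
    rewrite ek /phiQ (e3 l) -[l.+1%:R]natr1; move: l%:R => L; rewrite /phi3 /sigma; ring.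
  (* The difference vanishes at [N = 3]. For [4 <= N], submodularity reduces [hypot N 2 - hypot N 1]
     to its value at [N = 4], which is below [hypot 3 2 - hypot 3 1]. *)
  case: N34 => [eN|N4]; last first.
    apply: strict; rewrite eq.
    have : hypot N 2 + hypot 4 1 <= hypot N 1 + hypot 4 2 by apply: hypot_submod; lra.
    have : hypot 4 2 <= 448 / 100 :> R by apply: hypot_le; lra.
    have : 412 / 100 <= hypot 4 1 :> R by apply: le_hypot; lra.
    by lra.
  split=> [|_]; first by lra.
  split=> //; congr _.+1; apply/eqP; rewrite -leqn0 -(ler_nat R).
  by move: lN; rewrite -natr1; lra.
- apply: strict; case: l lN ek => [|l] lN ek.
    have {}ek : k = 2%N by rewrite ek.
    by rewrite ek /phiQ /phi2 /sigma (hypotC 2%:R N); lra.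
  have {}ek : k = l.+3 by rewrite ek.
  rewrite ek (e3 l) in g23; rewrite ek /phiQ (e3 l) -[l.+1%:R]natr1; move: l%:R g23 => L g23.
  by rewrite /phi3 /sigma; lra.
apply: strict; case: l lN ek => [|[|l]] lN ek; first by rewrite ek in nc.
  have {}ek : k = 2%N by rewrite ek.
  by rewrite ek /phiQ /phi2 /sigma (hypotC 2 N) (hypotC 2 1); lra.
have {}ek : k = l.+3 by rewrite ek.
rewrite ek (e3 l) in g23; rewrite ek /phiQ (e3 l) (e2 l); move: l%:R g23 => L g23.
by rewrite /phi3 /sigma (hypotC 2 1); lra.
Qed.

(* For [N = 3] the tree is a path on four vertices, and choosing its other
   inner vertex as the center gives a canonical configuration. *)
Definition tied N a b c l :=
  N = 3 /\ ([/\ ~~ a, b, ~~ c & l = 0%N] \/ [/\ a, b, ~~ c & l = 1%N]).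

Lemma sigma_le N a b c l k : N = 3 \/ 4 <= N -> l%:R <= N - 2 ->
    k = (a + b + c + l)%N ->
  sigma N a b c l%:R k%:R <= phiQ N k /\
  (sigma N a b c l%:R k%:R = phiQ N k ->
     (0 < k)%N /\ canonical a b c k \/ tied N a b c l).
Proof.
move=> N34 lN ek; have N3 : 3 <= N by lra.
case: a ek => ek.
  have k0 : (0 < k)%N by rewrite ek.
  have [cn | nc] := boolP (canonical true b c k).
    by rewrite (sigma_canonical N ek k0 cn); split=> //; left.
  have [-> h] := sigma_true_lt N34 lN ek nc; split=> // /h[eN hb hc el].
  by right; split=> //; right.
have [e32 e22 /andP[e31 e31'] /andP[e12 e12']] := hypot_bounds.
suff [lt | [lt ti]] : sigma N false b c l%:R k%:R < phiQ N k \/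
    sigma N false b c l%:R k%:R <= phiQ N k /\ tied N false b c l.
  - by split; [apply: ltW | move=> e; rewrite e ltxx in lt].
  - by split=> // _; right.
(* If some leaf is in [A], it is exchanged for the center. Otherwise only the four choices of [b]
   and [c] remain. *)
case: l lN ek => [|l] lN ek; last first.
  left; have ek' : k = (true + b + c + l)%N by rewrite ek addnS.
  have lN' : l%:R <= N - 2 by move: lN; rewrite -natr1; lra.
  have lt : sigma N false b c l.+1%:R k%:R < sigma N true b c l%:R k%:R.
    rewrite -natr1; apply: sigma_lt_swap => //.
    by move: lN; rewrite -natr1 ler0n /=; lra.
  apply: lt_le_trans lt _.
  have [cn | nc] := boolP (canonical true b c k).
    by rewrite (sigma_canonical N (ek' : k = _)) // ek'.
  by have [] := sigma_true_lt N34 lN' ek' nc.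
have d y : 0 <= y -> 0 <= hypotd N y by move=> ?; rewrite subr_ge0 ler_hypot //; lra.
have d1 : 0 <= (N - 2) * hypotd N 1 by rewrite mulr_ge0 ?d; lra.
have d2 : 0 <= hypotd N 2 by rewrite d.
have d3 : 0 <= hypotd N 3 by rewrite d.
have fN := hypot_gel N 1.
case: b c ek => [] [] /= ->.
- left; rewrite -subr_gt0 /phiQ /phi2 /sigma /=.
  have : hypot 3 2 <= hypot N 2 by apply: ler_hypot; lra.
  by rewrite (hypotC 2 3); move: d1 d2 d3; rewrite /hypotd; lra.
(* Here [u] is joined only to the vertex of degree 2, which for [N = 3] is an inner vertex of the
   path just like the center. *)
- case: N34 => [e3|N4]; last first.
    left; rewrite -subr_gt0 /phiQ /phi1 /sigma /=.
    have [d21 /andP[d32 d22] e2 e2' e3] := hypotd_bounds N4.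
    have : 2 * hypotd N 1 <= (N - 2) * hypotd N 1 by rewrite ler_wpM2r; lra.
    have : hypot (N - 1) 3 <= hypot N 2.
      by apply: hypot_le; rewrite ?hypot_ge0 // sqr_hypot; lra.
    by rewrite (hypotC 1 3); move: d21 e2'; rewrite /hypotd; lra.
  right; split; last by split=> //; left.
  have e2 : 3 - 1 = 2 :> R by ring.
  rewrite e3 /phiQ /phi1 /sigma /= e2.
  by rewrite (hypotC 1 3) (hypotC 2 3) (hypotC 1 2); lra.
- left; rewrite -subr_gt0 /phiQ /phi1 /sigma /=.
  by move: d1 d2; rewrite /hypotd; lra.
left; rewrite -subr_gt0 /phiQ /phi1 /sigma /= (hypotC 2 1).
by move: d1 d2; rewrite /hypotd; lra.
Qed.

End NearStarValues.

(** * Values for a star whose center is not in [A] *)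

Section StarValues.
Variable R : realType.
Local Open Scope ring_scope.
Local Notation hypot := (@hypot R).
Implicit Types (N K : R) (k : nat).

Definition phiS N K := K * (hypot K 2 + hypot N 2) + (N - K) * hypot N 1.

Lemma phi_starE n k : phi_star R n k = phiS (n%:R - 2) k%:R.
Proof.
have e4 : 4 = 2 ^+ 2 :> R by ring.
have e1 N : N ^+ 2 + 1 = N ^+ 2 + 1 ^+ 2 by rewrite expr1n.
rewrite /phi_star /phiS e1 e4 -!/(hypot _ _).
by move: n%:R k%:R => N K; ring.
Qed.

(** The values agree because [Qstar n 1] and [Qprime n 1] are the same graph. *)
Lemma phiS1 N : phiS N 1 = phi1 N.
Proof. by rewrite /phiS /phi1; ring. Qed.

(** Rules out [Qstar] as a competitor in part (a) for [k = 2, 3]. From [k = 4] on and for large [N]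
    the order is reversed. *)
Lemma phiS_lt N k : 3 <= N -> (1 < k < 4)%N -> phiS N k%:R < phiQ N k.
Proof.
move=> N3; have [e32 e22 /andP[e31 _] _] := hypot_bounds R.
have N0 : 0 < N by lra.
have f23 : hypot N 2 < hypot N 3 by apply: ltr_hypot; lra.
case: k => [|[|[|[|k]]]] // _; rewrite -subr_gt0 /phiQ.
  by rewrite /phi2 /phiS; lra.
have := hypot_midconvex 1 N0; have -> : 1 + 2 = 3 :> R by ring.
have : hypot 3 2 < hypot 3 3 by apply: ltr_hypot; lra.
by rewrite /phi3 /phiS (hypotC 3 N); lra.
Qed.

(* The bound 21, that is [23 <= n], comes from [k = 4], where the difference
   is 0.009 at [N = 21] and negative at [N = 20]. *)
Lemma phi3_lt_phiS N k : 21 <= N -> (4 <= k)%N -> k%:R <= N ->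
  phi3 N k%:R < phiS N k%:R.
Proof.
move=> N21; case: k => [|[|[|[|k]]]] // _ kN; set K : R := k.+4%:R in kN *.
have N0 : N != 0 by rewrite gt_eqF; lra.
(* The norms [hypot N c] are expanded as [N + c ^+ 2 / 2 * t]. This is an upper bound; for the lower
   bound at [c = 2] the coefficient 2 is lowered to 399/200. *)
pose t := N^-1; have tN : t * N = 1 by rewrite mulVf.
have t0 : 0 < t by rewrite invr_gt0; lra.
have t21 : t <= 1 / 21 by nra.
have f2 : N + 399 / 200 * t <= hypot N 2.
  apply: le_hypot; have : t ^+ 2 <= 1 / 441 by nra.
  have -> : (N + 399 / 200 * t) ^+ 2
     = N ^+ 2 + 399 / 100 * (t * N) + (399 / 200) ^+ 2 * t ^+ 2 by field.
  by rewrite tN; lra.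
have f1 : hypot N 1 <= N + 1 / 2 * t.
  apply: hypot_le; first by lra.
  have -> : (N + 1 / 2 * t) ^+ 2 = N ^+ 2 + t * N + (1 / 2 * t) ^+ 2 by field.
  by have := sqr_ge0 (1 / 2 * t); rewrite tN; lra.
have f3 : hypot N 3 <= N + 9 / 2 * t.
  apply: hypot_le; first by lra.
  have -> : (N + 9 / 2 * t) ^+ 2 = N ^+ 2 + 9 * (t * N) + (9 / 2 * t) ^+ 2 by field.
  by have := sqr_ge0 (9 / 2 * t); rewrite tN; lra.
have e32 : hypot 3 2 <= 649 / 180 :> R by apply: hypot_le; lra.
(* In [phiS - phi3] the norms [hypot N 2], [hypot N 1], [hypot N 3] keep the coefficients 3, -1, -1.
   Their bounds add up to [N + 197 / 200 * t]. *)
suff : hypot K N + hypot K 3 + hypot 3 2 < N + 2 * hypot K 2 + 197 / 200 * t.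
  by rewrite -subr_gt0 -[_ < phiS _ _]subr_gt0 /phi3 /phiS; lra.
have K_cases : [\/ K = 4, K = 5, K = 6 | 7 <= K].
  by rewrite /K; case: (k) => [|[|[|j]]]; [constructor 1 | constructor 2 | constructor 3
    | constructor 4; rewrite ler_nat].
clearbody K; have [eK|eK|eK|K7] := K_cases.
- rewrite eK; have : hypot 4 N <= N + 8 * t.
    apply: hypot_le; first by lra.
    have -> : (N + 8 * t) ^+ 2 = N ^+ 2 + 16 * (t * N) + (8 * t) ^+ 2 by ring.
    by have := sqr_ge0 (8 * t); rewrite tN; lra.
  have : hypot 4 3 <= 5 :> R by apply: hypot_le; lra.
  have : 1364 / 305 <= hypot 4 2 :> R by apply: le_hypot; lra.
  by lra.
- rewrite eK; have : hypot 5 N <= N + 6 / 10 by apply: hypot_le; nra.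
  have : hypot 5 3 <= 59 / 10 :> R by apply: hypot_le; lra.
  have : 53 / 10 <= hypot 5 2 :> R by apply: le_hypot; lra.
  by lra.
- rewrite eK; have : hypot 6 N <= N + 9 / 10 by apply: hypot_le; nra.
  have : hypot 6 3 <= 68 / 10 :> R by apply: hypot_le; lra.
  have : 63 / 10 <= hypot 6 2 :> R by apply: le_hypot; lra.
  by lra.
(* Chord bound for [K <= N]; 29/70 is slightly above [sqrt 2 - 1]. *)
have : hypot K N <= N + 29 / 70 * K.
  have : 0 <= K * (N - K) by apply: mulr_ge0; lra.
  have := sqr_ge0 K; move=> *; apply: hypot_le; first by lra.
  have -> : (N + 29 / 70 * K) ^+ 2 = N ^+ 2 + 29 / 35 * (K * N) + 841 / 4900 * K ^+ 2 by field.
  by lra.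
have h7 : 72 / 10 <= hypot 7 2 :> R by apply: le_hypot; lra.
have h2 : 72 / 10 <= hypot K 2 by apply: (le_trans h7); apply: ler_hypot; lra.
have : hypot K 3 <= hypot K 2 + 34 / 100.
  by apply: hypot_le; [lra | rewrite [leRHS]sqrrD sqr_hypot; lra].
have := hypot_gel K 2.
by lra.
Qed.

End StarValues.

(** * The Sombor index of an induced subgraph *)

Section InducedSombor.
Variables (R : realType) (G : sgraph).
Implicit Types (X : {set G}) (x y : G).

(** Also used for [x] outside [X]: [ndeg S u] counts the neighbours of [u] in the tree [S]. *)
Definition ndeg X x := #|[set y in X | adj x y]|.

(** The Sombor index of the subgraph induced by [X], summed over ordered pairs so that no edge sets
    are involved. *)
Definition indSO X : R :=
  ((\sum_(x in X) \sum_(y in X | adj x y) hypot (ndeg X x)%:R (ndeg X y)%:R) / 2)%R.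

Lemma ndegT x : ndeg [set: G] x = deg x.
Proof. by apply: eq_card => y; rewrite !inE. Qed.

Lemma SO_indSO : SO R G = indSO [set: G].
Proof.
rewrite /indSO; under eq_bigl do rewrite inE.
under eq_bigr => x _ do under eq_bigl do rewrite inE.
under eq_bigr => x _ do under eq_bigr do rewrite !ndegT.
rewrite (pair_big_dep predT (@adj G) (fun x y => hypot (deg x)%:R%R (deg y)%:R%R)) /=.
(* Ordered pairs are grouped by the edge that they span; each group has exactly two members. *)
rewrite (partition_big (fun p => [set p.1; p.2]) (mem (edges G))) /=; last first.
  move=> p adj_p; change ([set p.1; p.2] \in edges G).
  by apply/imsetP; exists p; rewrite ?inE.
apply: (canRL (mulfK _)); first by rewrite pnatr_eq0.
rewrite mulr_suml; apply: eq_bigr => e /imsetP[[a b]]; rewrite inE /= => adj_ab ->.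
have neq_ab : a != b by apply: contraTneq adj_ab => ->; rewrite adj_irr.
rewrite [RHS](eq_bigr (fun=> Num.sqrt (\sum_(x in [set a; b]) (deg x)%:R ^+ 2)%R)); last first.
  move=> [x y] /= /andP[adj_xy /eqP <-]; rewrite big_setU1 ?big_set1 // inE.
  by apply: contraTneq adj_xy => ->; rewrite adj_irr.
rewrite sumr_const mulr_natr; congr (_ *+ _)%R.
transitivity #|[set (a, b); (b, a)]|; first by rewrite cards2 xpair_eqE (negPf neq_ab).
apply: eq_card => -[x y]; rewrite !inE /= !xpair_eqE unfold_in /=.
apply/orP/andP => [|[adj_xy /eqP eq_e]].
  by case=> /andP[/eqP-> /eqP->]; rewrite ?adj_ab ?(adj_sym b) ?adj_ab ?[[set b; a]]setUC.
have xab : x \in [set a; b] by rewrite -eq_e set21.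
have yab : y \in [set a; b] by rewrite -eq_e set22.
have neq_xy : x != y by apply: contraTneq adj_xy => ->; rewrite adj_irr.
move: xab yab neq_xy; rewrite !inE.
by do 2!case/orP=> /eqP->; rewrite ?eqxx //=; auto.
Qed.

End InducedSombor.

Lemma giso_deg (G H : sgraph) (f : G -> H) : bijective f ->
  (forall x y, adj (f x) (f y) = adj x y) -> forall x, deg (f x) = deg x.
Proof.
move=> [g fK gK] adj_f x; rewrite /deg -(card_imset _ (can_inj fK)).
apply: eq_card => y; rewrite !inE; apply/idP/imsetP => [adj_fx | [z]].
  by exists (g y); rewrite ?gK // inE -adj_f gK.
by rewrite inE => adj_xz ->; rewrite adj_f.
Qed.

Lemma SO_giso (R : realType) (G H : sgraph) : giso G H -> SO R G = SO R H.
Proof.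
move=> [f f_bij adj_f]; have deg_f := giso_deg f_bij adj_f.
have [g fK gK] := f_bij.
rewrite !SO_indSO /indSO; congr (_ / _)%R.
rewrite [RHS](reindex f); last exact: onW_bij.
apply: eq_big => [x|x _]; first by rewrite !inE.
rewrite [RHS](reindex f); last exact: onW_bij.
apply: eq_big => [y|y _]; first by rewrite !inE adj_f.
by rewrite !ndegT !deg_f.
Qed.

(** * Graphs whose adjacency depends only on vertex labels *)

Section Labelling.
Variables (G : sgraph) (X : {set G}) (m : nat) (E : nat -> nat -> bool).
Variables (lab : G -> nat) (cnt : nat -> nat).
Hypothesis lab_lt : forall x, x \in X -> lab x < m.
Hypothesis card_lab : forall i, i < m -> #|[set x in X | lab x == i]| = cnt i.

Lemma sum_lab (V : nmodType) (F : nat -> V) :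
  (\sum_(x in X) F (lab x) = \sum_(i < m) F i *+ cnt i)%R.
Proof.
transitivity (\sum_(x in X) \sum_(i < m | i == lab x :> nat) F i)%R.
  by apply: eq_bigr => x Xx; rewrite big_ord1_eq lab_lt.
rewrite (exchange_big_dep predT) //=; apply: eq_bigr => i _.
rewrite -card_lab // -sumr_const; apply: eq_bigl => x.
by rewrite !inE eq_sym.
Qed.

Hypothesis adj_lab : {in X &, forall x y, adj x y = E (lab x) (lab y)}.

Definition lab_deg i := \sum_(j < m) E i j * cnt j.

Lemma ndeg_lab x : x \in X -> ndeg X x = lab_deg (lab x).
Proof.
move=> Xx; rewrite /ndeg -sum1_card /lab_deg.
rewrite (eq_bigr (fun j : 'I_m => (E (lab x) j : nat) *+ cnt j)%R); last first.
  by move=> j _; rewrite -mulr_natr natn.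
rewrite -(sum_lab (fun j => (E (lab x) j : nat))) /= [RHS]big_mkcond [LHS]big_mkcond.
apply: eq_bigr => y _; rewrite !inE; case Xy: (y \in X) => //=.
by rewrite adj_lab //; case: (E _ _).
Qed.

Lemma indSO_lab (R : realType) : indSO R X =
  ((\sum_(i < m) \sum_(j < m) (if E i j then
     hypot (lab_deg i)%:R (lab_deg j)%:R *+ (cnt i * cnt j) else 0)) / 2)%R.
Proof.
congr (_ / _)%R.
pose F i : R := (\sum_(j < m) (if E i j then
  @hypot R (lab_deg i)%:R (lab_deg j)%:R *+ cnt j else 0))%R.
transitivity (\sum_(x in X) F (lab x) : R)%R; last first.
  rewrite sum_lab; apply: eq_bigr => i _; rewrite -sumrMnl; apply: eq_bigr => j _.
  by case: ifP; rewrite ?mul0rn // mulnC mulrnA.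
apply: eq_bigr => x Xx.
pose H j : R := (if E (lab x) j then hypot (lab_deg (lab x))%:R (lab_deg j)%:R else 0)%R.
transitivity (\sum_(y in X) H (lab y))%R; last first.
  by rewrite sum_lab; apply: eq_bigr => j _; rewrite /H; case: ifP; rewrite ?mul0rn.
rewrite big_mkcondr; apply: eq_bigr => y Xy.
by rewrite /H adj_lab // !ndeg_lab.
Qed.

End Labelling.

(** The [j]-th vertex of a label class of [G] is sent to the [j]-th vertex of the same class of
    [H]. *)
Lemma giso_lab (G H : sgraph) (m : nat) (E : nat -> nat -> bool)
    (lG : G -> nat) (lH : H -> nat) :
    (forall x, lG x < m) -> (forall x, lH x < m) ->
    (forall x y, adj x y = E (lG x) (lG y)) ->
    (forall x y, adj x y = E (lH x) (lH y)) ->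
    (forall i, i < m -> #|[set x | lG x == i]| = #|[set x | lH x == i]|) ->
  giso G H.
Proof.
move=> ltG ltH adjG adjH card_l.
pose CG i := enum [set x | lG x == i]; pose CH i := enum [set x | lH x == i].
have size_C i : i < m -> size (CG i) = size (CH i).
  by move=> lt_im; rewrite -!cardE card_l.
have inCG x : x \in CG (lG x) by rewrite mem_enum inE.
have idx x : index x (CG (lG x)) < size (CH (lG x)) by rewrite -size_C // index_mem.
(* A default for [nth], which cannot be fixed in advance since [H] might be empty. The class of
   [lG x] in [H] is nonempty because it has the size of the class of [x]. *)
have H_of (x : G) : H.
  by case: (CH (lG x)) (idx x) => [|y s _] //; exact: y.
pose f x := nth (H_of x) (CH (lG x)) (index x (CG (lG x))).
have lf x : lH (f x) = lG x.
  by have := mem_nth (H_of x) (idx x); rewrite mem_enum inE => /eqP.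
have f_inj : injective f.
  move=> x y eq_f; have eq_l : lG x = lG y by rewrite -!lf eq_f.
  have : nth (H_of x) (CH (lG x)) (index x (CG (lG x)))
       = nth (H_of x) (CH (lG x)) (index y (CG (lG x))).
    rewrite -/(f x) eq_f /f eq_l; apply: set_nth_default.
    by rewrite idx.
  move/eqP; rewrite nth_uniq ?enum_uniq ?idx //; last by rewrite eq_l idx.
  by move/eqP/(congr1 (nth x (CG (lG x)))); rewrite !nth_index // eq_l.
have card_sum (K : sgraph) (lK : K -> nat) : (forall x, lK x < m) ->
    #|K| = \sum_(i < m) #|[set x | lK x == i]|.
  move=> ltK; transitivity (\sum_(x in [set: K]) 1); first by rewrite sum1_card cardsT.
  have ltK' x : x \in [set: K] -> lK x < m by [].
  rewrite (sum_lab ltK' (fun i _ => erefl) (fun=> 1)); apply: eq_bigr => i _.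
  by rewrite natn; apply: eq_card => x; rewrite !inE.
exists f; last by move=> x y; rewrite adjH adjG !lf.
apply: inj_card_bij => //; rewrite (card_sum G lG) // (card_sum H lH) //.
by apply/eq_leq/eq_bigr => i _; rewrite card_l.
Qed.

(** * Growing a tree by pendant vertices *)

Section Growth.
Variable G : sgraph.
Implicit Types (S X : {set G}) (p q x y z : G).

(** An induced subtree, given by an order in which its vertices are attached as pendant vertices.
    Structural induction on it is the induction on [T]. *)
Inductive built : {set G} -> Prop :=
| built1 x : built [set x]
| builtU1 S p q of built S & p \notin S & q \in S
    & (forall y, y \in S -> adj p y = (y == q)) : built (p |: S).

Lemma ndeg_sum X x : ndeg X x = \sum_(y in X) adj x y.
Proof.
by rewrite /ndeg -sum1dep_card big_mkcondr; apply: eq_bigr => y _; case: (adj x y).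
Qed.

Lemma ndegU1 X p x : p \notin X -> ndeg (p |: X) x = adj x p + ndeg X x.
Proof. by move=> pX; rewrite !ndeg_sum big_setU1. Qed.

Lemma ndegU1_self X p : p \notin X -> ndeg (p |: X) p = ndeg X p.
Proof. by move=> pX; rewrite ndegU1 ?adj_irr. Qed.

Lemma ndeg_pendant S p q : q \in S -> (forall y, y \in S -> adj p y = (y == q)) ->
  ndeg S p = 1.
Proof.
move=> Sq adj_p; rewrite ndeg_sum (bigD1 q) //= adj_p // eqxx big1 ?addn0 //.
by move=> y /andP[Sy /negPf ne]; rewrite adj_p // ne.
Qed.

Lemma built_nonempty S : built S -> exists x, x \in S.
Proof. by case=> [x | S' p q _ _ _ _]; [exists x | exists p]; rewrite !inE eqxx. Qed.

Lemma built_ndeg_gt0 S x : built S -> 1 < #|S| -> x \in S -> 0 < ndeg S x.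
Proof.
move=> bS; elim: bS x => [z x | {}S p q bS IH pS qS adj_p x]; first by rewrite cards1.
move=> _; rewrite !inE => /orP[/eqP-> | Sx].
  by rewrite ndegU1_self // (ndeg_pendant qS adj_p).
rewrite ndegU1 // addn_gt0; have [S1 | S1] := ltnP 1 #|S|; first by rewrite IH ?orbT.
suff -> : x = q by rewrite adj_sym adj_p ?eqxx.
by apply: (card_le1_eqP S1).
Qed.

(** Twice the number of edges of a tree. It later forces all vertices other than those of known
    large degree to be leaves. *)
Lemma built_handshake S : built S -> \sum_(x in S) ndeg S x + 2 = #|S|.*2.
Proof.
elim=> [x | {}S p q bS IH pS qS adj_p].
  by rewrite big_set1 cards1 ndeg_sum big_set1 adj_irr.
rewrite big_setU1 //= ndegU1_self // (ndeg_pendant qS adj_p).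
under eq_bigr do rewrite ndegU1 // adj_sym.
rewrite big_split -ndeg_sum (ndeg_pendant qS adj_p) cardsU1 pS doubleD -IH.
by rewrite /= !addnA.
Qed.

Lemma built_path S x y : built S -> x \in S -> y \in S -> exists s,
  [/\ path (@adj G) x s, last x s = y & {subset x :: s <= S}].
Proof.
move=> bS; elim: bS x y => [z x y | {}S p q bS IH pS qS adj_p x y].
  by rewrite !inE => /eqP-> /eqP->; exists [::]; split=> // t; rewrite !inE.
have adj_pq : adj p q by rewrite adj_p.
rewrite !inE => /orP[/eqP-> | Sx] /orP[/eqP-> | Sy].
- by exists [::]; split=> // t; rewrite !inE => ->.
- have [s [s_path s_last s_sub]] := IH _ _ qS Sy; exists (q :: s).
  split=> //=; first by rewrite adj_pq.
  by move=> t; rewrite inE => /orP[/eqP-> | /s_sub St]; rewrite !inE ?eqxx ?St ?orbT.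
- have [s [s_path s_last s_sub]] := IH _ _ Sx qS; exists (rcons s p).
  split=> //; rewrite ?last_rcons ?rcons_path ?s_path ?s_last 1?adj_sym //.
  move=> t; rewrite -rcons_cons mem_rcons inE.
  by case/orP=> [/eqP-> | /s_sub St]; rewrite !inE ?eqxx ?St ?orbT.
have [s [s_path s_last s_sub]] := IH _ _ Sx Sy; exists s; split=> // t /s_sub St.
by rewrite !inE St orbT.
Qed.

Lemma built_acyclic S p q q' : acyclic G -> built S -> p \notin S ->
  q \in S -> q' \in S -> adj p q -> adj p q' -> q = q'.
Proof.
move=> acyc bS pS qS q'S adj_pq adj_pq'; apply/eqP/negP => /negP neq_q.
have [s [s_path s_last s_sub]] := built_path bS qS q'S.
(* A repetition-free path from [q] to [q'] closes to a cycle through [p]. *)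
case/shortenP: s_path s_last => s' s'_path s'_uniq s'_sub s'_last.
have /acyc : ucycle (@adj G) (p :: q :: s').
  apply/andP; split; last first.
    rewrite cons_uniq s'_uniq andbT; apply: contra pS => p_in; apply: s_sub.
    by move: p_in; rewrite !inE => /orP[-> // | /s'_sub->]; rewrite orbT.
  by rewrite /= adj_pq rcons_path s'_path s'_last adj_sym.
(* The size bound of [acyclic] leaves only the empty path, that is [q = q']. *)
by case: s' s'_last {s'_path s'_uniq s'_sub} neq_q => //= ->; rewrite eqxx.
Qed.

(** A built set can be enlarged until it is everything: connectedness gives an edge leaving it, and
    acyclicity makes the new end adjacent to only one vertex of the set. *)
Lemma tree_built : is_tree G -> built [set: G].
Proof.
case=> -[G_gt0 conn] acyc.
suff H n : n < #|G| -> exists2 S, built S & #|S| = n.+1.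
  have [S bS cS] := H #|G|.-1 (eq_leq (prednK G_gt0)).
  have <- // : S = [set: G].
  by apply/eqP; rewrite eqEcard subsetT cardsT cS prednK /=.
elim: n => [|n IH] lt_n.
  by have /card_gt0P[x _] := G_gt0; exists [set x]; [exact: built1 | rewrite cards1].
have [S bS cS] := IH (ltnW lt_n).
have [p pS [q qS adj_pq]] : exists2 p, p \notin S & exists2 q, q \in S & adj p q.
  have /subsetPn[y _ yS] : ~~ ([set: G] \subset S).
    by apply: contraL lt_n => /subset_leq_card; rewrite cardsT cS -leqNgt.
  have [x Sx] := built_nonempty bS.
  have [/existsP[p /andP[pS /existsP[q /andP[qS pq]]]] | no_edge] :=
      boolP [exists p, (p \notin S) && [exists q, (q \in S) && adj p q]].
    by exists p => //; exists q.
  have clS : closed (@adj G) (mem S).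
    move=> a b ab; apply/idP/idP => [aS | bS'].
      apply: contraNT no_edge => bS'; apply/existsP; exists b; rewrite bS'.
      by apply/existsP; exists a; rewrite adj_sym ab andbT.
    apply: contraNT no_edge => aS; apply/existsP; exists a; rewrite aS.
    by apply/existsP; exists b; rewrite ab andbT.
  by have := closed_connect clS (conn x y); rewrite /= Sx (negPf yS).
exists (p |: S); last by rewrite cardsU1 pS cS.
apply: (builtU1 bS pS qS) => y Sy; apply/idP/eqP => [adj_py | -> //].
exact: built_acyclic acyc bS pS Sy qS adj_py adj_pq.
Qed.

End Growth.

Lemma built_val (G : sgraph) (u : G) (S : {set del_vertex u}) :
  built S -> built (val @: S).
Proof.
elim=> [x | {}S p q bS IH pS qS adj_p]; first by rewrite imset_set1; exact: built1.
rewrite imsetU1; apply: (builtU1 IH (q := val q)); rewrite ?(mem_imset _ _ val_inj) //.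
by move=> _ /imsetP[y Sy ->]; rewrite (inj_eq val_inj) -adj_p.
Qed.

Lemma built_del (G : sgraph) (u : G) : is_tree (del_vertex u) -> built [set~ u].
Proof.
move/tree_built/built_val; congr built; apply/setP => x; rewrite !inE.
apply/imsetP/idP => [[y _ ->] | x_u]; first exact: (valP y).
by exists (Sub x x_u).
Qed.

(** * Effect of one additional vertex on the Sombor index *)

Section AddVertex.
Variables (R : realType) (G : sgraph).
Implicit Types (X : {set G}) (p x y z : G).
Local Open Scope ring_scope.

(* The two endpoints of an edge are raised separately: by submodularity of
   [hypot] this overestimates the effect of raising both. *)
Lemma indSOU1_le X p : p \notin X ->
  indSO R (p |: X) <= indSO R X + \sum_(z in X | adj p z)
    (hypot (ndeg X p)%:R (ndeg X z).+1%:R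
     + \sum_(y in X | adj z y) hypotd (ndeg X z).+1%:R (ndeg X y)%:R).
Proof.
move=> pX; pose d x : R := (ndeg X x)%:R; pose d' x : R := (ndeg (p |: X) x)%:R.
pose e x : R := if adj p x then 1 else 0.
have d'E x : d' x = d x + e x.
  rewrite /d' /d /e ndegU1 // natrD addrC adj_sym; congr (_ + _); by case: ifP.
have d'p : d' p = d p by rewrite /d' ndegU1_self.
have sumX F x : \sum_(y in p |: X | adj x y) F y =
    (if adj p x then F p else 0) + \sum_(y in X | adj x y) F y :> R.
  by rewrite [LHS]big_mkcondr big_setU1 //= (adj_sym x p) -big_mkcondr.
pose N := \sum_(z in X | adj p z) hypot (d p) (d' z).
pose M := \sum_(x in X) \sum_(y in X | adj x y) e x * hypotd (d' x) (d y).
(* Every ordered pair is charged the rise at each of its ends, with the old degree at the other end.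
   Exchanging the sums shows that first and second ends both contribute [M]. *)
have bound : \sum_(x in X) \sum_(y in X | adj x y) hypot (d' x) (d' y)
    <= \sum_(x in X) \sum_(y in X | adj x y) hypot (d x) (d y) + (M + M).
  rewrite {2}/M [X in _ <= _ + (_ + X)](exchange_big_dep (mem X)) /=; last first.
    by move=> x y _ /andP[].
  rewrite -!big_split /=; apply: ler_sum => x Xx.
  rewrite [X in _ <= _ + (_ + X)](eq_bigl (fun y => (y \in X) && adj x y)); last first.
    by move=> y; rewrite Xx adj_sym.
  rewrite -!big_split /=; apply: ler_sum => y /andP[Xy xy].
  have dx0 : 0 <= d x := ler0n _ _; have dy0 : 0 <= d y := ler0n _ _.
  rewrite !d'E /hypotd /e; case: ifP => _; case: ifP => _; rewrite ?addr0 ?addrK ?mul0r ?mul1r.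
  - have : hypot (d x + 1) (d y + 1) + hypot (d x) (d y)
        <= hypot (d x + 1) (d y) + hypot (d x) (d y + 1) by apply: hypot_submod; lra.
    by rewrite (hypotC (d y + 1)) (hypotC (d y)); lra.
  - by lra.
  - by rewrite (hypotC (d y + 1)) (hypotC (d y)); lra.
  - by lra.
have eN : \sum_(x in X) (if adj p x then hypot (d' x) (d' p) else 0) = N.
  by rewrite -big_mkcondr; apply: eq_bigr => z _; rewrite hypotC d'p.
have eM : M = \sum_(z in X | adj p z) \sum_(y in X | adj z y) hypotd (d' z) (d y).
  rewrite [RHS]big_mkcondr; apply: eq_bigr => x _; rewrite -mulr_sumr /e.
  by case: ifP; rewrite ?mul0r ?mul1r.
have eNM : \sum_(z in X | adj p z) (hypot (ndeg X p)%:R (ndeg X z).+1%:R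
     + \sum_(y in X | adj z y) hypotd (ndeg X z).+1%:R (ndeg X y)%:R) = N + M.
  rewrite eM -big_split; apply: eq_bigr => z /andP[_ pz].
  by rewrite d'E /e pz /d natr1.
have -> : indSO R (p |: X) = (N + (N
    + \sum_(x in X) \sum_(y in X | adj x y) hypot (d' x) (d' y))) / 2.
  rewrite /indSO big_setU1 //= sumX adj_irr add0r; congr ((_ + _) / 2).
    by apply: eq_bigr => z _; rewrite -/(d' _) d'p.
  by rewrite -[X in X + _]eN -big_split; apply: eq_bigr => x _; rewrite sumX.
by rewrite eNM /indSO -/(d _); move: bound; rewrite /d; lra.
Qed.

End AddVertex.

(** * Trees close to a star *)

Definition labelled (G : sgraph) (X : {set G}) m (E : nat -> nat -> bool) (cnt : nat -> nat) :=
  exists lab : G -> nat, [/\ forall x, x \in X -> lab x < m,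
    forall i, i < m -> #|[set x in X | lab x == i]| = cnt i
    & {in X &, forall x y, adj x y = E (lab x) (lab y)}].

Lemma labelled_giso (G H : sgraph) m E cnt :
  labelled [set: G] m E cnt -> labelled [set: H] m E cnt -> giso G H.
Proof.
move=> [lG [ltG cG adjG]] [lH [ltH cH adjH]].
apply: (giso_lab (m := m) (E := E) (lG := lG) (lH := lH)) => [x|x|x y|x y|i lt_i].
- exact: ltG.
- exact: ltH.
- exact: adjG.
- exact: adjH.
rewrite -[LHS](_ : #|[set x in [set: G] | lG x == i]| = _); last first.
  by apply: eq_card => x; rewrite !inE.
rewrite -[RHS](_ : #|[set x in [set: H] | lH x == i]| = _); last first.
  by apply: eq_card => x; rewrite !inE.
by rewrite cG ?cH.
Qed.

Lemma labelled_card (G : sgraph) (X : {set G}) m E cnt :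
  labelled X m E cnt -> #|X| = \sum_(i < m) cnt i.
Proof.
move=> [lab [lab_lt card_lab _]]; rewrite -sum1_card.
rewrite (sum_lab lab_lt card_lab (fun=> 1)); apply: eq_bigr => i _.
by rewrite natn.
Qed.

(** Edges are compared only between inhabited labels, so [f] may treat empty classes arbitrarily and
    merge them with others. *)
Lemma relabel (G : sgraph) (X : {set G}) m E cnt E' cnt' (f : nat -> nat) :
    labelled X m E cnt -> (forall i, i < m -> f i < m) ->
    (forall i, i < m -> \sum_(j < m) (f j == i) * cnt j = cnt' i) ->
    (forall i j, i < m -> j < m -> 0 < cnt i -> 0 < cnt j -> E i j = E' (f i) (f j)) ->
  labelled X m E' cnt'.
Proof.
move=> [lab [lab_lt card_lab adj_lab]] f_lt cnt'E EE'.
exists (f \o lab); split=> [x Xx|i lt_i|x y Xx Xy] /=.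
- exact/f_lt/lab_lt.
- rewrite -cnt'E //; transitivity (\sum_(x in X) (f (lab x) == i)).
    by rewrite -sum1dep_card big_mkcondr; apply: eq_bigr => x _; case: eqP.
  rewrite (sum_lab lab_lt card_lab (fun j => (f j == i : nat))).
  by apply: eq_bigr => j _; rewrite -mulr_natr natn.
have cnt_gt0 z : z \in X -> 0 < cnt (lab z).
  by move=> Xz; rewrite -card_lab ?lab_lt //; apply/card_gt0P; exists z; rewrite inE Xz /=.
by rewrite adj_lab // EE' ?lab_lt ?cnt_gt0.
Qed.

(* Labels: 0 the vertex of degree [#|S| - 2] in the tree, 1 its neighbour [w]
   of degree 2, 2 the other neighbour of [w], 3 the vertex outside the tree,
   4 and 5 the remaining leaves, adjacent to 3 or not. *)
Definition near_star_edge (a b c : bool) i j :=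
  match i, j with
  | 0, 1 | 1, 0 | 1, 2 | 2, 1 | 0, 4 | 4, 0 | 0, 5 | 5, 0 | 3, 4 | 4, 3 => true
  | 0, 3 | 3, 0 => a
  | 1, 3 | 3, 1 => b
  | 2, 3 | 3, 2 => c
  | _, _ => false
  end.

Definition near_star_cnt l r i := nth 0 [:: 1; 1; 1; 1; l; r] i.

Definition near_star (G : sgraph) (X : {set G}) a b c l r :=
  labelled X 6 (near_star_edge a b c) (near_star_cnt l r).

Lemma near_star_deg a b c l r i : i < 6 ->
  lab_deg 6 (near_star_edge a b c) (near_star_cnt l r) i =
  nth 0 [:: a + (1 + l + r); 2 + b; 1 + c; a + b + c + l; 2; 1] i.
Proof.
case: i => [|[|[|[|[|[|i]]]]]] // _; rewrite /lab_deg /near_star_cnt;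
by rewrite !big_ord_recl big_ord0 /=; lia.
Qed.

Lemma near_star_indSO (R : realType) (G : sgraph) (X : {set G}) a b c l r :
    near_star X a b c l r ->
  indSO R X = sigma (2 + l + r)%:R%R a b c l%:R%R (a + b + c + l)%:R%R.
Proof.
move=> [lab [lab_lt card_lab adj_lab]]; rewrite (indSO_lab lab_lt card_lab adj_lab).
have degE := near_star_deg a b c l r.
rewrite !big_ord_recl !big_ord0 !degE //= /near_star_cnt /= !mulr1n !mul1n.
rewrite !muln1 -![(hypot _ _ *+ _)%R]mulr_natr; set K : R := (_ + l)%:R%R.
have eC : (a + (1 + l + r))%:R%R = (if a then (2 + l + r)%:R else (2 + l + r)%:R - 1)%R :> R.
  by case: (a) => //; rewrite -[(2 + l + r)%N]/(1 + l + r).+1 -natr1 addrK.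
have eW : (2 + b)%:R%R = (if b then 3 else 2)%R :> R by case: (b).
have eP : (1 + c)%:R%R = (if c then 2 else 1)%R :> R by case: (c).
have eN : (2 + l + r)%:R%R = (2 + l%:R + r%:R)%R :> R by rewrite !natrD.
rewrite /sigma; move: eC eW eP K; rewrite {}eN; set N := (2 + _ + _)%R.
have er : (N - 2 - l%:R = r%:R)%R by rewrite /N; ring.
rewrite {}er; clearbody N; move: l%:R%R r%:R%R => L Rr.
set C := (a + _)%:R%R; set W := (2 + b)%:R%R; set P := (1 + c)%:R%R.
clearbody C W P => eC eW eP K.
rewrite (hypotC W C) (hypotC P W) (hypotC C K) (hypotC W K) (hypotC P K) (hypotC 2 C).
rewrite (hypotC 2 K) (hypotC 1 C) eC eW eP {eC eW eP}.
by case: a b c {C W P card_lab adj_lab degE} => [] [] []; lra.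
Qed.

(** The tree is a path on four vertices, and [f] reverses it. The remaining leaf has label 5 here
    and 4 in [near_star_tie3]; the other label is empty, so one [f] serves both. *)
Lemma near_star_tie1 (G : sgraph) (X : {set G}) :
  near_star X false true false 0 1 -> near_star X true false false 0 1.
Proof.
move=> lX; apply: (relabel (f := nth 0 [:: 1; 0; 5; 3; 2; 2]) lX).
- by do 6!case=> //.
- by case=> [|[|[|[|[|[|i]]]]]] // _; rewrite !big_ord_recl big_ord0.
by case=> [|[|[|[|[|[|i]]]]]] [|[|[|[|[|[|j]]]]]].
Qed.

Lemma near_star_tie3 (G : sgraph) (X : {set G}) :
  near_star X true true false 1 0 -> near_star X true true true 0 1.
Proof.
move=> lX; apply: (relabel (f := nth 0 [:: 1; 0; 5; 3; 2; 2]) lX).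
- by do 6!case=> //.
- by case=> [|[|[|[|[|[|i]]]]]] // _; rewrite !big_ord_recl big_ord0.
by case=> [|[|[|[|[|[|i]]]]]] [|[|[|[|[|[|j]]]]]].
Qed.

(** * Recognizing stars and stars with one subdivided edge *)

Section TreeShapes.
Variables (G : sgraph).
Implicit Types (S X : {set G}) (p q u x y z : G).

Lemma ndeg1_adj S x y z : ndeg S x = 1 -> y \in S -> adj x y -> z \in S ->
  adj x z = (z == y).
Proof.
move=> deg_x Sy xy Sz; apply/idP/eqP => [xz | -> //].
have /card_le1_eqP : #|[set t in S | adj x t]| <= 1 by rewrite -/(ndeg S x) deg_x.
by apply; rewrite !inE ?Sy ?Sz.
Qed.

Lemma built_sum_ge S (T : {set G}) : built S -> 1 < #|S| -> T \subset S ->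
  #|T| <= \sum_(x in T) ndeg S x.
Proof.
move=> bS S1 TS; rewrite -sum1_card; apply: leq_sum => x Tx.
by rewrite built_ndeg_gt0 // (subsetP TS).
Qed.

(* Labels: 0 the center, 1 the vertex outside the tree, 2 and 3 the leaves,
   adjacent to 1 or not. *)
Definition star_edge (a : bool) i j :=
  match i, j with
  | 0, 2 | 2, 0 | 0, 3 | 3, 0 | 1, 2 | 2, 1 => true
  | 0, 1 | 1, 0 => a
  | _, _ => false
  end.

Definition star_cnt l r i := nth 0 [:: 1; 1; l; r] i.

Lemma built_star S u c : built S -> u \notin S -> c \in S -> 1 < #|S| ->
    #|S| <= (ndeg S c).+1 ->
  exists l r, [/\ labelled (u |: S) 4 (star_edge (adj u c)) (star_cnt l r),
    l + r + 1 = #|S| & ndeg S u = adj u c + l].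
Proof.
move=> bS uS Sc S1 deg_c.
have c_ge : ndeg S c <= #|S :\ c|.
  apply: subset_leq_card; apply/subsetP => y; rewrite !inE => /andP[-> cy]; rewrite andbT.
  by apply: contraTneq cy => ->; rewrite adj_irr.
have cardS : #|S :\ c|.+1 = #|S| by rewrite [#|S|](cardsD1 c) Sc.
have adj_c y : y \in S -> adj c y = (y != c).
  move=> Sy; have /subset_leqif_cards[_] : [set y in S | adj c y] \subset S :\ c.
    apply/subsetP => t; rewrite !inE => /andP[-> ct]; rewrite andbT.
    by apply: contraTneq ct => ->; rewrite adj_irr.
  rewrite -/(ndeg S c) eqn_leq c_ge -ltnS cardS deg_c => /esym/eqP/setP/(_ y).
  by rewrite !inE Sy andbT.
(* The degrees add up to [2 * #|S| - 2]. The center takes [#|S| - 1], which leaves just one for each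
   other vertex. *)
have deg1 x : x \in S -> x != c -> ndeg S x = 1.
  move=> Sx xc; have Sx' : x \in S :\ c by rewrite !inE xc.
  have := built_handshake bS; rewrite (big_setD1 c) //= (big_setD1 x) //=.
  have sub : S :\ c :\ x \subset S by rewrite !subDset !subsetU ?subxx ?orbT.
  have := built_sum_ge bS S1 sub; have := built_ndeg_gt0 bS S1 Sx.
  by move: cardS; rewrite [#|S :\ c|](cardsD1 x) Sx' -addnn; lia.
have adj_leaf x y : x \in S -> x != c -> y \in S -> adj x y = (y == c).
  by move=> Sx xc Sy; apply: ndeg1_adj Sc _ Sy; rewrite ?deg1 // adj_sym adj_c.
have uc : u != c by apply: contraNneq uS => ->.
pose lab x := if x == c then 0 else if x == u then 1 else if adj u x then 2 else 3.
pose num i := #|[set x in u |: S | lab x == i]|.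
have lX : labelled (u |: S) 4 (star_edge (adj u c)) (star_cnt (num 2) (num 3)).
  exists lab; split=> [x _|i|x y].
  - by rewrite /lab; do 3!case: ifP => // _.
  - case: i => [|[|[|[|i]]]] // _; rewrite /star_cnt /=.
      rewrite -[RHS](cards1 c); apply: eq_card => x; rewrite !inE /lab.
      case: (eqVneq x c) => [-> |]; first by rewrite Sc orbT.
      by case: (x == u); case: (adj u x); rewrite ?andbF.
    rewrite -[RHS](cards1 u); apply: eq_card => x; rewrite !inE /lab.
    case: (eqVneq x u) => [-> |]; first by rewrite (negPf uc) eqxx.
    by case: (x == c); case: (adj u x); rewrite ?andbF.
  rewrite !inE /lab; case: (eqVneq x u) => [-> _|xu /= Sx].
    rewrite (negPf uc); case: (eqVneq y u) => [-> _|yu /= Sy].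
      by rewrite (negPf uc) adj_irr.
    by case: (eqVneq y c) => [->|yc]; [case: (adj u c) | case: (adj u y)].
  case: (eqVneq y u) => [-> _|yu /= Sy].
    rewrite (negPf uc) adj_sym.
    by case: (eqVneq x c) => [->|xc]; [case: (adj u c) | case: (adj u x)].
  case: (eqVneq x c) => [->|xc].
    by rewrite adj_c //; case: (eqVneq y c) => yc //=; case: (adj u y).
  rewrite adj_leaf //; case: (eqVneq y c) => [_|yc]; first by case: (adj u x).
  by case: (adj u x); case: (adj u y).
exists (num 2), (num 3); split=> //.
  have := labelled_card lX; rewrite cardsU1 uS !big_ord_recl big_ord0 /star_cnt /=.
  lia.
rewrite ndeg_sum (big_setD1 c) //=; congr (_ + _); rewrite /num -sum1dep_card.
rewrite big_mkcond /= [RHS]big_mkcond; apply: eq_bigr => x _; rewrite !inE /lab.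
case: (eqVneq x c) => [_|xc]; rewrite ?andbF //=.
by case: (eqVneq x u) => [->|xu] /=; rewrite ?(negPf uS) //; case: (x \in S); case: (adj u x).
Qed.

Lemma built_near_star S u c : built S -> u \notin S -> c \in S -> 3 < #|S| ->
    ndeg S c + 2 = #|S| ->
  exists a b d l r, [/\ near_star (u |: S) a b d l r, l + r + 3 = #|S|
    & ndeg S u = a + b + d + l].
Proof.
move=> bS uS Sc S3 deg_c; have S1 : 1 < #|S| by lia.
(* [C] contains [c] itself, so exactly one other vertex [p] is not adjacent to [c]; its neighbour
   [w] is the vertex of degree 2. *)
pose C := [set y in S | ~~ adj c y].
have Cc : c \in C by rewrite inE Sc adj_irr.
have cardC : #|C| = 2.
  have := cardsID [set y | adj c y] S; rewrite -deg_c => /eqP.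
  rewrite (_ : S :&: _ = [set y in S | adj c y]) -/(ndeg S c) ?eqn_add2l; last first.
    by apply/setP => y; rewrite !inE.
  by move/eqP <-; apply: eq_card => y; rewrite !inE andbC.
have /cards1P[p Cp] : #|C :\ c| == 1 by rewrite -eqSS -cardC (cardsD1 c C) Cc.
have adj_c y : y \in S -> adj c y = (y != c) && (y != p).
  move=> Sy; have /setP/(_ y) := Cp; rewrite !inE Sy /=.
  by case: (eqVneq y c) => [->|_] /= => [_|<-]; rewrite ?adj_irr ?negbK.
have [pc Sp] : p != c /\ p \in S.
  by have : p \in C :\ c by [rewrite Cp inE]; rewrite !inE => /andP[-> /andP[->]].
have cp : adj c p = false by rewrite adj_c // eqxx andbF.
have [w Sw pw] : exists2 w, w \in S & adj p w.
  have := built_ndeg_gt0 bS S1 Sp; rewrite card_gt0 => /set0Pn[w].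
  by rewrite inE => /andP[]; exists w.
have wc : w != c by apply: contraTneq pw => ->; rewrite adj_sym cp.
have wp : w != p by apply: contraTneq pw => ->; rewrite adj_irr.
have cw : adj c w by rewrite adj_c // wc wp.
have Sw' : w \in S :\ c by rewrite !inE wc.
have deg_w : 1 < ndeg S w.
  rewrite /ndeg (cardsD1 c) (cardsD1 p) !inE Sc Sp pc !(adj_sym w) cw pw.
  by rewrite addnA addn1.
(* [c] takes [#|S| - 2] and [w] at least 2 of the degree sum [2 * #|S| - 2], which leaves at most
   one for each other vertex. *)
have deg1 x : x \in S -> x != c -> x != w -> ndeg S x = 1.
  move=> Sx xc xw; have Sx' : x \in S :\ c :\ w by rewrite !inE xc xw.
  have := built_handshake bS.
  rewrite (big_setD1 c) //= (big_setD1 w) //= (big_setD1 x) //=.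
  have sub : S :\ c :\ w :\ x \subset S by rewrite !subDset !subsetU ?subxx ?orbT.
  have := built_sum_ge bS S1 sub; have := built_ndeg_gt0 bS S1 Sx.
  have := cardsD1 x (S :\ c :\ w); have := cardsD1 w (S :\ c); have := cardsD1 c S.
  by rewrite Sx' Sw' Sc -addnn; move: deg_c deg_w; clear; lia.
have adj_leaf x y : x \in S -> x != c -> x != w -> x != p -> y \in S ->
    adj x y = (y == c).
  move=> Sx xc xw xp Sy; apply: ndeg1_adj Sc _ Sy; rewrite ?deg1 //.
  by rewrite adj_sym adj_c // xc.
have adj_p y : y \in S -> adj p y = (y == w).
  by move=> Sy; apply: ndeg1_adj Sw _ Sy; rewrite ?deg1 // eq_sym.
have adj_w y : y \in S -> adj w y = (y == c) || (y == p).
  move=> Sy; case: (eqVneq y c) => [->|yc] /=; first by rewrite adj_sym.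
  case: (eqVneq y p) => [->|yp] /=; first by rewrite adj_sym.
  case: (eqVneq y w) => [->|yw]; first by rewrite adj_irr.
  by rewrite adj_sym adj_leaf // (negPf wc).
have uc : u != c by apply: contraNneq uS => ->.
have uw : u != w by apply: contraNneq uS => ->.
have up : u != p by apply: contraNneq uS => ->.
pose lab x := if x == c then 0 else if x == w then 1 else if x == p then 2
  else if x == u then 3 else if adj u x then 4 else 5.
pose num i := #|[set x in u |: S | lab x == i]|.
have lab_u : lab u = 3 by rewrite /lab eqxx (negPf uc) (negPf uw) (negPf up).
have [lab_lt card_lab adj_lab] : [/\ forall x, x \in u |: S -> lab x < 6,
    forall i, i < 6 -> #|[set x in u |: S | lab x == i]| = near_star_cnt (num 4) (num 5) i
  & {in u |: S &, forall x y, adj x y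
     = near_star_edge (adj u c) (adj u w) (adj u p) (lab x) (lab y)}].
  split=> [x _|i|x y].
  - by rewrite /lab; do 5!case: ifP => // _.
  - have one t : t \in u |: S -> (forall x, (lab x == i) = (x == t)) ->
        #|[set x in u |: S | lab x == i]| = 1.
      move=> Xt lab_i; rewrite -[RHS](cards1 t); apply: eq_card => x.
      by rewrite !inE lab_i; case: (eqVneq x t) Xt => [->|_]; rewrite ?andbF ?inE ?andbT.
    have inX t : t \in S -> t \in u |: S by rewrite !inE orbC => ->.
    have splits x : [|| x == c, x == w, x == p, x == u | lab x \in [:: 4; 5]].
      by rewrite /lab; do 4!(case: ifP => //= _); case: ifP.
    have lab_c : lab c = 0 by rewrite /lab eqxx.
    have lab_w : lab w = 1 by rewrite /lab eqxx (negPf wc).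
    have lab_p : lab p = 2 by rewrite /lab eqxx (negPf pc) eq_sym (negPf wp).
    have lab_eq j t : j < 4 -> lab t = j -> t \in [:: c; w; p; u] ->
      forall x, (lab x == j) = (x == t).
      move=> lt_j <- {lt_j} t_in x; apply/eqP/eqP => [|-> //].
      have := splits x; rewrite !inE in t_in *.
      case/or4P: t_in => /eqP->; rewrite ?lab_c ?lab_w ?lab_p ?lab_u;
        case/or4P=> [/eqP->|/eqP->|/eqP->|/orP[/eqP->|]] //;
        rewrite ?lab_c ?lab_w ?lab_p ?lab_u //; move=> lab_x lab_x';
        by rewrite lab_x' in lab_x.
    case: i one => [|[|[|[|[|[|i]]]]]] // one _; rewrite /near_star_cnt /=.
    + by apply: (one c); [exact: inX | apply: lab_eq; rewrite ?inE ?eqxx ?orbT].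
    + by apply: (one w); [exact: inX | apply: lab_eq; rewrite ?inE ?eqxx ?orbT].
    + by apply: (one p); [exact: inX | apply: lab_eq; rewrite ?inE ?eqxx ?orbT].
    + by apply: (one u); [rewrite !inE eqxx | apply: lab_eq; rewrite ?inE ?eqxx ?orbT].
  have adj_u_lab z : z \in S ->
      adj u z = near_star_edge (adj u c) (adj u w) (adj u p) 3 (lab z).
    move=> Sz; have zu : z != u by apply: contraTneq Sz => ->.
    rewrite /lab (negPf zu); do 3!(case: eqVneq => [->|_] //).
    by case: (adj u z).
  have edgeC i j : near_star_edge (adj u c) (adj u w) (adj u p) i j
      = near_star_edge (adj u c) (adj u w) (adj u p) j i.
    by case: i j => [|[|[|[|[|[|i]]]]]] [|[|[|[|[|[|j]]]]]].
  rewrite !inE; case: (eqVneq x u) => [-> _|xu /= Sx].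
    case: (eqVneq y u) => [-> _|yu /= Sy]; first by rewrite lab_u adj_irr.
    by rewrite lab_u adj_u_lab.
  case: (eqVneq y u) => [-> _|yu /= Sy]; first by rewrite lab_u adj_sym edgeC adj_u_lab.
  rewrite /lab (negPf xu) (negPf yu).
  case: (eqVneq x c) => [->|xc].
    case: (eqVneq y c) => [->|yc]; first by rewrite adj_irr.
    case: (eqVneq y w) => [->|yw]; first by rewrite cw.
    case: (eqVneq y p) => [->|yp]; first by rewrite cp.
    by rewrite adj_c // yc yp; case: (adj u y).
  case: (eqVneq x w) => [->|xw].
    rewrite adj_w //; case: (eqVneq y c) => [//|yc].
    case: (eqVneq y w) => [->|yw]; first by rewrite (negPf wp).
    by case: (eqVneq y p) => [//|yp]; case: (adj u y).
  case: (eqVneq x p) => [->|xp].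
    rewrite adj_p //; case: (eqVneq y c) => [->|yc]; first by rewrite eq_sym (negPf wc).
    case: (eqVneq y w) => [//|yw]; case: (eqVneq y p) => [//|yp].
    by case: (adj u y).
  rewrite adj_leaf //; case: (eqVneq y c) => [_|yc]; first by case: (adj u x).
  case: (eqVneq y w) => [_|yw]; first by case: (adj u x).
  case: (eqVneq y p) => [_|yp]; first by case: (adj u x).
  by case: (adj u x); case: (adj u y).
have lX : near_star (u |: S) (adj u c) (adj u w) (adj u p) (num 4) (num 5) by exists lab.
exists (adj u c), (adj u w), (adj u p), (num 4), (num 5); split=> //.
  have := labelled_card lX; rewrite cardsU1 uS !big_ord_recl big_ord0 /near_star_cnt /=.
  by clear; lia.
rewrite -(ndegU1_self uS) (ndeg_lab lab_lt card_lab adj_lab) ?setU11 //.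
by rewrite lab_u near_star_deg.
Qed.

End TreeShapes.

(** * The bound by induction on the tree *)

Section QuasiTreeBound.
Variables (R : realType) (G : sgraph).
Implicit Types (S : {set G}) (p q u x y z : G).

Lemma near_star_bound (X : {set G}) a b c l r n : 2 < n -> l + r + 2 = n ->
    near_star X a b c l r ->
  (indSO R X <= phiQ n%:R (a + b + c + l)%N)%R /\
  (indSO R X = phiQ n%:R%R (a + b + c + l) ->
     0 < a + b + c + l /\ canonical a b c (a + b + c + l) \/
     n = 3 /\ ([/\ ~~ a, b, ~~ c & l = 0] \/ [/\ a, b, ~~ c & l = 1])).
Proof.
move=> n3 en lX; rewrite (near_star_indSO R lX).
rewrite (_ : 2 + l + r = n); last by rewrite -en -addnA addnC.
have [||-> tie] := @sigma_le R n%:R%R a b c l (a + b + c + l) _ _ erefl.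
- by move: n3; rewrite leq_eqVlt => /orP[/eqP <-|n4]; [left | right; rewrite ler_nat].
- by rewrite -natrB -?en ?addnK ?leq_addl // ler_nat leq_addr.
split=> // /tie[h|[n3' h]]; first by left.
by right; split=> //; apply/eqP; rewrite -(eqr_nat R) n3'.
Qed.

(** [#|S|%:R - 1] is the parameter [N = n - 2]. The first conclusion is the one that the induction
    uses; the second confines equality to trees with a vertex of degree [#|S| - 2]. *)
Lemma built_bound S u : built S -> u \notin S -> 3 < #|S| ->
    (forall x, x \in S -> ndeg S x + 2 <= #|S|) ->
  (indSO R (u |: S) <= phiQ (#|S|%:R - 1) (ndeg S u))%R /\
  ((forall x, x \in S -> ndeg S x + 3 <= #|S|) ->
   (indSO R (u |: S) < phiQ (#|S|%:R - 1) (ndeg S u))%R).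
Proof.
move=> bS; elim: bS => [x|{}S p q bS IH pS Sq adj_p]; first by rewrite cards1.
move=> uS' S'3 deg_le; have bS' := builtU1 bS pS Sq adj_p.
set S' := p |: S in uS' S'3 deg_le bS' *.
have [/existsP[c /andP[Sc /eqP deg_c]] | no_c] :=
    boolP [exists c, (c \in S') && (ndeg S' c + 2 == #|S'|)].
  split=> [|/(_ c Sc)]; last by rewrite -deg_c leq_add2l.
  have [a [b [d [l [r [lX card_lr deg_u]]]]]] := built_near_star bS' uS' Sc S'3 deg_c.
  have [|/= le_X _] := near_star_bound _ (erefl (l + r + 2)) lX.
    by rewrite -ltnS -addnS card_lr.
  have -> : (#|S'|%:R - 1 = (l + r + 2)%:R :> R)%R by rewrite -card_lr addnS -natr1 addrK.
  by rewrite deg_u.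
have {no_c}deg_lt x : x \in S' -> ndeg S' x + 3 <= #|S'|.
  move=> Sx; rewrite addnS ltn_neqAle deg_le // andbT.
  by apply: contra no_c => deg_x; apply/existsP; exists x; rewrite Sx.
suff lt : (indSO R (u |: S') < phiQ (#|S'|%:R - 1) (ndeg S' u))%R.
  by split=> [|_ //]; exact: ltW.
have cS' : #|S'| = #|S|.+1 by rewrite cardsU1 pS.
(* On four vertices the degree condition allows only degrees at most 1, but the degree sum is 6. *)
have S3 : 3 < #|S|.
  rewrite ltnNge; apply/negP => S3; have eS : #|S'| = 4 by lia.
  have := built_handshake bS'; have : \sum_(x in S') ndeg S' x <= \sum_(x in S') 1.
    by apply: leq_sum => x /deg_lt; rewrite eS; lia.
  by rewrite sum1_card eS; lia.
have uS : u \notin S by apply: contra uS'; rewrite !inE orbC => ->.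
have up : u != p by apply: contraNneq uS' => ->; rewrite setU11.
have degS x : x \in S -> ndeg S x <= ndeg S' x by move=> _; rewrite ndegU1 ?leq_addl.
have deg_leS x : x \in S -> ndeg S x + 2 <= #|S|.
  move=> Sx; have Sx' : x \in S' by rewrite !inE Sx orbT.
  by move: (degS _ Sx) (deg_lt _ Sx'); rewrite cS'; clear; lia.
have [{IH}IH _] := IH uS S3 deg_leS.
have pX : p \notin u |: S by rewrite !inE negb_or pS eq_sym up.
have := indSOU1_le R pX; rewrite setUCA -/S'.
set X := u |: S in pX IH *.
have dXu : ndeg X u = ndeg S u by rewrite ndegU1_self.
have dXp : ndeg X p = adj u p + 1.
  by rewrite ndegU1 // (ndeg_pendant Sq adj_p) adj_sym.
have dXS x : ndeg X x = adj u x + ndeg S x by rewrite ndegU1 // adj_sym.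
pose k := ndeg S u.
have dq : (ndeg X q).+1 + 2 <= #|S| + adj u q.
  have Sq' : q \in S' by rewrite !inE Sq orbT.
  have := deg_lt _ Sq'; rewrite ndegU1 // adj_sym adj_p // eqxx cS' dXS.
  by clear; lia.
pose T z := (hypot (ndeg X p)%:R (ndeg X z).+1%:R
     + \sum_(y in X | adj z y) hypotd (ndeg X z).+1%:R (ndeg X y)%:R : R)%R.
have sumT : (\sum_(z in X | adj p z) T z = (if adj u p then T u else 0) + T q)%R.
  rewrite big_mkcondr /= big_setU1 //= (adj_sym p u); congr (_ + _)%R.
  rewrite (bigD1 q) //= adj_p // eqxx big1 ?addr0 //.
  by move=> z /andP[Sz /negPf zq]; rewrite adj_p // zq.
rewrite -/(T _) [X in (_ <= _ + X)%R]sumT => leX.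
have Tq (D : R) : ((ndeg X q).+1%:R <= D ->
    T q <= hypot D (ndeg X p)%:R + (D - 1))%R.
  move=> leD; rewrite /T hypotC; apply: lerD.
    by apply: ler_hypot; rewrite ?ler0n ?lexx //= leD.
  apply: (@le_trans _ _ (\sum_(y in X | adj q y) 1)%R).
    by apply: ler_sum => y _; apply: hypotd_le1; rewrite ler1n.
  rewrite sumr_const (_ : #|_| = ndeg X q); last by apply: eq_card => y; rewrite inE.
  by move: leD; rewrite -natr1; lra.
(* A neighbour of [u] in [S] has degree at least 2 in [X]: it sees [u] and a vertex of the tree. *)
have Tu : (T u <= hypot k.+1%:R (ndeg X p)%:R + k%:R * hypotd k.+1%:R 2)%R.
  rewrite /T hypotC dXu -/k lerD2l.
  apply: (@le_trans _ _ (\sum_(y in X | adj u y) hypotd k.+1%:R 2)%R).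
    apply: ler_sum => y /andP[]; rewrite !inE => /orP[/eqP-> | Sy uy].
      by rewrite adj_irr.
    apply: hypotd_antitone; rewrite ?ler1n // ler0n ler_nat /= dXS uy.
    by rewrite ltnS built_ndeg_gt0 // ltnW // ltnW.
  rewrite sumr_const (_ : #|_| = ndeg X u); last by apply: eq_card => y; rewrite inE.
  by rewrite dXu mulr_natl.
have k_le : k <= #|S|.
  by rewrite /k /ndeg; apply/subset_leq_card/subsetP => y; rewrite inE => /andP[].
pose N : R := (#|S'|%:R - 1)%R.
have eN : N = #|S|%:R%R by rewrite /N cS' -natr1 addrK.
have N4 : (4 <= N)%R by rewrite eN ler_nat.
have kN : (k%:R <= N)%R by rewrite eN ler_nat.
have dqN : ((ndeg X q).+1%:R <= N - 1)%R.
  rewrite lerBrDr natr1 eN ler_nat.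
  by move: dq; case: (adj u q); clear; lia.
rewrite -/N -eN in leX IH *; rewrite -/k in IH.
have -> : ndeg S' u = adj u p + k by rewrite ndegU1.
have TqN := Tq _ dqN; rewrite dXp in TqN Tu.
case up' : (adj u p) leX TqN Tu => leX TqN Tu; rewrite /= in leX; last first.
  rewrite -[(false + 1)%N]/1 in TqN; rewrite -[(false + k)%N]/k.
  have := phiQ_step N4 kN.
  by move: IH leX TqN; clear; lra.
rewrite -[(true + 1)%N]/2 in TqN Tu; rewrite -[(true + k)%N]/k.+1.
have [k0 | k_gt0] := posnP k; last first.
  have := phiQS_step N4 k_gt0 kN.
  by move: IH leX TqN Tu; clear; lra.
(* With [k = 0] the vertex [p] is the only neighbour of [u]. This improves the bound on the degree
   of [q] by one, as [phi1_step] requires. *)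
have uq : adj u q = false.
  apply/negP => uq; suff : 0 < k by rewrite k0.
  by rewrite card_gt0; apply/set0Pn; exists q; rewrite inE Sq.
have {}TqN : (T q <= hypot (N - 2) 2 + (N - 2 - 1))%R.
  have := Tq (N - 2)%R; rewrite dXp up'; apply.
  by rewrite lerBrDr -natrD eN ler_nat; move: dq; rewrite uq; clear; lia.
have := phi1_step N4; rewrite k0 in IH Tu *.
by move: IH leX TqN Tu; rewrite /phiQ; clear; lra.
Qed.

End QuasiTreeBound.

(** * The extremal graphs *)

Lemma card_option_set (T : finType) (P : pred (option T)) :
  #|[set x | P x]| = P None + #|[set x | P (Some x)]|.
Proof.
rewrite (cardsD1 None) inE; congr (_ + _); rewrite -[RHS](card_imset _ Some_inj).
apply: eq_card => -[x|]; rewrite !inE /=; last by apply/esym/imsetP => -[].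
by rewrite (mem_imset _ _ Some_inj) inE.
Qed.

Lemma card_ord_itv m (P : pred nat) i j : (forall x, x < m -> P x = (i <= x < j)) ->
  #|[set x : 'I_m | P x]| = minn j m - minn i m.
Proof.
move=> PE; rewrite -sum1dep_card (eq_bigl (fun x : 'I_m => i <= x < j)); last first.
  by move=> x; rewrite PE.
elim: m {PE} => [|m IH]; first by rewrite big_ord0; lia.
by rewrite big_mkcond big_ord_recr -big_mkcond /= IH; case: ifP; lia.
Qed.

(** Covers [Qgraph] with [t = k] and [Qstar] with [t = k + 1]. Leaves are numbered from 1, so [t.-1]
    of them are joined to the new vertex. *)
Lemma attach_star_labelled m t a (A : {set star m}) : 0 < t <= m ->
    (forall i : 'I_m, (i \in A) = if i == 0 :> nat then a else i < t) ->
  labelled [set: attach A] 4 (star_edge a) (star_cnt t.-1 (m - t)).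
Proof.
move=> t_m AE; pose g i := if i == 0 then 0 else if i < t then 2 else 3.
have g0 x : (g x == 0) = (0 <= x < 1) by rewrite /g; case: x => [|x] //=; case: ifP.
have g1 x : (g x == 1) = (0 <= x < 0) by rewrite /g; case: x => [|x] //=; case: ifP.
have g2 x : (g x == 2) = (1 <= x < t) by rewrite /g; case: x => [|x] //=; case: ifP.
have g3 x : x < m -> (g x == 3) = (t <= x < m).
  by rewrite /g => ->; case: x => [|x] /=; [lia | rewrite ltnNge; case: ifP; lia].
exists (fun x => if x is Some i then g (nat_of_ord i) else 1); split.
- by case=> [i|] _ //; rewrite /g; case: (nat_of_ord i) => [|j] //=; case: ifP.
- move=> i lt_i; transitivity #|[set x : option 'I_m |
     (if x is Some y then g (nat_of_ord y) else 1) == i]|.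
    by apply: eq_card => x; rewrite !inE.
  rewrite card_option_set; case: i lt_i => [|[|[|[|i]]]] // _.
  + by rewrite (card_ord_itv (fun x _ => g0 x)) /star_cnt /=; lia.
  + by rewrite (card_ord_itv (fun x _ => g1 x)) /star_cnt /=; lia.
  + by rewrite (card_ord_itv (fun x _ => g2 x)) /star_cnt /=; lia.
  + by rewrite (card_ord_itv g3) /star_cnt /=; lia.
case=> [[[|i] lt_i]|] [[[|j] lt_j]|] _ _ //=; rewrite ?AE /= /star_adj /g /=;
  by repeat case: ifP.
Qed.

Lemma Qgraph_labelled n k : 0 < k < n ->
  labelled [set: Qgraph n k] 4 (star_edge true) (star_cnt k.-1 (n.-1 - k)).
Proof.
move=> k_n; apply: attach_star_labelled => [|i]; first by lia.
by rewrite inE; case: eqP => // ->; lia.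
Qed.

Lemma Qstar_labelled n k : k < n.-1 ->
  labelled [set: Qstar n k] 4 (star_edge false) (star_cnt k (n.-1 - k.+1)).
Proof.
move=> k_n; apply: (@attach_star_labelled _ k.+1) => [|i]; first by lia.
by rewrite inE; case: eqP => [->|] //; case: (nat_of_ord i).
Qed.

Lemma Sprime_Qstar n : Sprime n = Qstar n 1.
Proof.
rewrite /Sprime /Qstar; congr attach; apply/setP => i; rewrite !inE.
by case: (nat_of_ord i) => [|[|j]].
Qed.

(** Here [u] is the star leaf of index 2, joined only to the center; the attached vertex is the
    pendant end of the subdivided edge. *)
Lemma Qprime_near_star1 n : 4 < n -> near_star [set: Qprime n 1] true false false 0 (n - 4).
Proof.
move=> n4; pose g i := nth 5 [:: 0; 1; 3] i.
have g0 x : (g x == 0) = (0 <= x < 1) by case: x => [|[|[|x]]] //; rewrite /g /= nth_nil.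
have g1 x : (g x == 1) = (1 <= x < 2) by case: x => [|[|[|x]]] //; rewrite /g /= nth_nil.
have g2 x : (g x == 2) = (0 <= x < 0) by case: x => [|[|[|x]]] //; rewrite /g /= nth_nil.
have g3 x : (g x == 3) = (2 <= x < 3) by case: x => [|[|[|x]]] //; rewrite /g /= nth_nil.
have g4 x : (g x == 4) = (0 <= x < 0) by case: x => [|[|[|x]]] //; rewrite /g /= nth_nil.
have g5 x : x < n.-1 -> (g x == 5) = (3 <= x < n.-1).
  by move=> ->; case: x => [|[|[|x]]] //; rewrite /g /= nth_nil.
exists (fun x : option 'I_n.-1 => if x is Some i then g (nat_of_ord i) else 2); split.
- by case=> [[[|[|[|i]]] lt_i]|] _ //; rewrite /g /= nth_nil.
- move=> i lt_i; transitivity #|[set x : option 'I_n.-1 |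
     (if x is Some y then g (nat_of_ord y) else 2) == i]|.
    by apply: eq_card => x; rewrite !inE.
  rewrite card_option_set /near_star_cnt; case: i lt_i => [|[|[|[|[|[|i]]]]]] // _.
  + by rewrite (card_ord_itv (fun x _ => g0 x)) /=; lia.
  + by rewrite (card_ord_itv (fun x _ => g1 x)) /=; lia.
  + by rewrite (card_ord_itv (fun x _ => g2 x)) /=; lia.
  + by rewrite (card_ord_itv (fun x _ => g3 x)) /=; lia.
  + by rewrite (card_ord_itv (fun x _ => g4 x)) /=; lia.
  + by rewrite (card_ord_itv g5) /=; lia.
case=> [[[|[|[|i]]] lt_i]|] [[[|[|[|j]]] lt_j]|] _ _ //=;
  by rewrite ?inE /= /star_adj /g /= ?nth_nil.
Qed.

(** Here [u] is the inner [None], added to the star in [Qgraph]; the outer [None] is the pendant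
    neighbour of leaf 1. The same holds in [Qprime_near_star3]. *)
Lemma Qprime_near_star2 n : 4 < n -> near_star [set: Qprime n 2] true true false 0 (n - 4).
Proof.
move=> n4; pose g i := nth 5 [:: 0; 1] i.
have g0 x : (g x == 0) = (0 <= x < 1) by case: x => [|[|x]] //; rewrite /g /= nth_nil.
have g1 x : (g x == 1) = (1 <= x < 2) by case: x => [|[|x]] //; rewrite /g /= nth_nil.
have g2 x : (g x == 2) = (0 <= x < 0) by case: x => [|[|x]] //; rewrite /g /= nth_nil.
have g3 x : (g x == 3) = (0 <= x < 0) by case: x => [|[|x]] //; rewrite /g /= nth_nil.
have g4 x : (g x == 4) = (0 <= x < 0) by case: x => [|[|x]] //; rewrite /g /= nth_nil.
have g5 x : x < n.-2 -> (g x == 5) = (2 <= x < n.-2).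
  by move=> ->; case: x => [|[|x]] //; rewrite /g /= nth_nil.
pose lab (x : option (option 'I_n.-2)) :=
  if x is Some y then if y is Some i then g (nat_of_ord i) else 3 else 2.
exists lab; split.
- by case=> [[[[|[|i]] lt_i]|]|] _ //; rewrite /= /g /= nth_nil.
- move=> i lt_i; transitivity #|[set x : option (option 'I_n.-2) | lab x == i]|.
    by apply: eq_card => x; rewrite !inE.
  rewrite !card_option_set /near_star_cnt /=; case: i lt_i => [|[|[|[|[|[|i]]]]]] // _.
  + by rewrite (card_ord_itv (fun x _ => g0 x)) /=; lia.
  + by rewrite (card_ord_itv (fun x _ => g1 x)) /=; lia.
  + by rewrite (card_ord_itv (fun x _ => g2 x)) /=; lia.
  + by rewrite (card_ord_itv (fun x _ => g3 x)) /=; lia.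
  + by rewrite (card_ord_itv (fun x _ => g4 x)) /=; lia.
  + by rewrite (card_ord_itv g5) /=; lia.
case=> [[[[|[|i]] lt_i]|]|] [[[[|[|j]] lt_j]|]|] _ _ //=;
  by rewrite ?inE /= /star_adj /g /= ?nth_nil.
Qed.

Lemma Qprime_near_star3 n k : 2 < k < n ->
  near_star [set: Qprime n k] true true true (k - 3) (n.-1 - k).
Proof.
case: k => [|[|[|k]]] // k_n; pose g i := if i < 2 then i else if i < k.+2 then 4 else 5.
have g0 x : (g x == 0) = (0 <= x < 1) by rewrite /g; case: x => [|[|x]] //=; case: ifP.
have g1 x : (g x == 1) = (1 <= x < 2) by rewrite /g; case: x => [|[|x]] //=; case: ifP.
have g2 x : (g x == 2) = (0 <= x < 0) by rewrite /g; case: x => [|[|x]] //=; case: ifP.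
have g3 x : (g x == 3) = (0 <= x < 0) by rewrite /g; case: x => [|[|x]] //=; case: ifP.
have g4 x : (g x == 4) = (2 <= x < k.+2) by rewrite /g; case: x => [|[|x]] //=; case: ifP.
have g5 x : x < n.-2 -> (g x == 5) = (k.+2 <= x < n.-2).
  by move=> ->; rewrite /g; case: x => [|[|x]] //=; rewrite [k.+2 <= _]leqNgt; case: ifP.
pose lab (x : option (option 'I_n.-2)) :=
  if x is Some y then if y is Some i then g (nat_of_ord i) else 3 else 2.
exists lab; split.
- by case=> [[[[|[|i]] lt_i]|]|] _ //; rewrite /= /g /=; case: ifP.
- move=> i lt_i; transitivity #|[set x : option (option 'I_n.-2) | lab x == i]|.
    by apply: eq_card => x; rewrite !inE.
  rewrite !card_option_set /near_star_cnt /=; case: i lt_i => [|[|[|[|[|[|i]]]]]] // _.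
  + by rewrite (card_ord_itv (fun x _ => g0 x)) /=; lia.
  + by rewrite (card_ord_itv (fun x _ => g1 x)) /=; lia.
  + by rewrite (card_ord_itv (fun x _ => g2 x)) /=; lia.
  + by rewrite (card_ord_itv (fun x _ => g3 x)) /=; lia.
  + by rewrite (card_ord_itv (fun x _ => g4 x)) /=; lia.
  + by rewrite (card_ord_itv g5) /=; lia.
case=> [[[[|[|i]] lt_i]|]|] [[[[|[|j]] lt_j]|]|] _ _ //=;
  by rewrite ?inE /= /star_adj /g /=; repeat case: ifP.
Qed.

Lemma Qprime_near_star n k : 4 < n -> 0 < k < n ->
  near_star [set: Qprime n k] true (1 < k) (2 < k) (k - 3) (n - 4 - (k - 3)).
Proof.
move=> n4; case: k => [|[|[|k]]] // k_n; rewrite ?subn0.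
- exact: Qprime_near_star1.
- exact: Qprime_near_star2.
have -> : n - 4 - (k.+3 - 3) = n.-1 - k.+3 by lia.
exact: Qprime_near_star3.
Qed.

(** * Values of the extremal graphs and the case distinction *)

Section Comparison.
Variable R : realType.

Lemma SO_Qprime n k : 4 < n -> 0 < k < n -> SO R (Qprime n k) = phi' R n k.
Proof.
move=> n4 k_n; have [k0 _] := andP k_n.
rewrite phi'E // SO_indSO (near_star_indSO R (Qprime_near_star n4 k_n)).
have -> : true + (1 < k) + (2 < k) + (k - 3) = k by case: (k) k0 => [|[|[|j]]] //= _; lia.
have -> : (2 + (k - 3) + (n - 4 - (k - 3)))%:R%R = (n%:R - 2)%R :> R.
  by rewrite -natrB; [congr _%:R%R; lia | lia].
apply: sigma_canonical => //; last by rewrite /canonical !eqxx.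
by case: (k) k0 => [|[|[|j]]] //= _; lia.
Qed.

Lemma star_indSO (G : sgraph) (X : {set G}) l r :
    labelled X 4 (star_edge false) (star_cnt l r) ->
  indSO R X = phiS (l + r)%:R%R l%:R%R.
Proof.
move=> [lab [lab_lt card_lab adj_lab]]; rewrite (indSO_lab lab_lt card_lab adj_lab).
have degE i : i < 4 -> lab_deg 4 (star_edge false) (star_cnt l r) i
    = nth 0 [:: l + r; l; 2; 1] i.
  case: i => [|[|[|[|i]]]] // _; rewrite /lab_deg /star_cnt;
  by rewrite !big_ord_recl big_ord0 /=; lia.
rewrite !big_ord_recl !big_ord0 !degE //= /star_cnt /= !mul1n !muln1.
rewrite -![(hypot _ _ *+ _)%R]mulr_natr /phiS.
have -> : r%:R%R = ((l + r)%:R - l%:R)%R :> R by rewrite natrD addrC addKr.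
move: (l + r)%:R%R l%:R%R => N L.
by rewrite (hypotC 2 N) (hypotC 1 N) (hypotC 2 L); lra.
Qed.

Lemma SO_Qstar n k : 4 < n -> k < n.-1 -> SO R (Qstar n k) = phi_star R n k.
Proof.
move=> n4 k_n; rewrite phi_starE SO_indSO (star_indSO (Qstar_labelled k_n)).
by congr phiS; rewrite -natrB; [congr _%:R%R; lia | lia].
Qed.

(** Shared by both parts: they differ only in how [phi_star] compares with [phi']. The bound on [k]
    in the first case excludes [k = n - 1]. *)
Lemma quasi_tree_dichotomy n k (G : sgraph) : 4 < n -> 0 < k ->
    quasi_tree_class n k G -> ~ giso G (Qgraph n k) ->
  giso G (Qstar n k) /\ k < n.-1 \/
  (SO R G <= phi' R n k)%R /\ (SO R G = phi' R n k -> giso G (Qprime n k)).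
Proof.
move=> n4 k0 [_ card_G [u [/built_del bS deg_u]]] notQ.
set S := [set~ u] in bS; have uS : u \notin S by rewrite !inE eqxx.
have cardS : #|S|.+1 = n by rewrite cardsC1 prednK // card_G; lia.
have XT : u |: S = [set: G] by apply/setP => x; rewrite !inE; case: eqP.
have dSu : ndeg S u = k by rewrite -(ndegU1_self uS) XT ndegT.
have S3 : 3 < #|S| by rewrite -ltnS cardS.
have [/existsP[c /andP[Sc deg_c]] | no_c] :=
    boolP [exists c, (c \in S) && (#|S| <= (ndeg S c).+1)].
  left; have [l [r [lX card_lr kE]]] := built_star bS uS Sc (ltnW (ltnW S3)) deg_c.
  rewrite XT dSu in lX kE; case uc : (adj u c) lX kE => lX kE.
    case: notQ; apply: labelled_giso lX _.
    have -> : l = k.-1 by rewrite kE.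
    have -> : r = n.-1 - k by move: cardS card_lr kE; clear; lia.
    by apply: Qgraph_labelled; rewrite k0; move: cardS card_lr kE; clear; lia.
  have k_n : k < n.-1 by move: cardS card_lr kE; clear; lia.
  split=> //; apply: labelled_giso lX _.
  have -> : l = k by rewrite kE.
  have -> : r = n.-1 - k.+1 by move: cardS card_lr kE; clear; lia.
  exact: Qstar_labelled.
right; have deg_le x : x \in S -> ndeg S x + 2 <= #|S|.
  move=> Sx; rewrite addn2 ltnNge; apply: contra no_c => deg_x.
  by apply/existsP; exists x; rewrite Sx.
have eN : (#|S|%:R - 1 = n%:R - 2 :> R)%R by rewrite -cardS -natr1; ring.
have [] := built_bound R bS uS S3 deg_le.
rewrite XT dSu -SO_indSO eN -phi'E // => le_SO lt_SO; split=> // eq_SO.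
(* Equality contradicts the strict bound unless some vertex has degree [#|S| - 2]. *)
have [c Sc deg_c] : exists2 c, c \in S & ndeg S c + 2 = #|S|.
  have [/existsP[c /andP[Sc /eqP deg_c]] | none] :=
      boolP [exists c, (c \in S) && (ndeg S c + 2 == #|S|)]; first by exists c.
  suff : (SO R G < phi' R n k)%R by rewrite eq_SO ltxx.
  apply: lt_SO => x Sx; rewrite addnS ltn_neqAle deg_le // andbT.
  by apply: contra none => deg_x; apply/existsP; exists x; rewrite Sx.
have [a [b [d [l [r [lX card_lr kE]]]]]] := built_near_star bS uS Sc S3 deg_c.
rewrite XT dSu in lX kE.
have N_gt2 : 2 < l + r + 2 by move: card_lr S3; clear; lia.
have [_] := near_star_bound R N_gt2 erefl lX.
have -> : (l + r + 2)%:R%R = (n%:R - 2)%R :> R.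
  rewrite -natrB; last by do 3!apply: ltnW.
  by congr _%:R%R; move: card_lr cardS; clear; lia.
rewrite -SO_indSO -kE -phi'E // => /(_ eq_SO).
have k_n : 0 < k < n by move: k0 kE card_lr cardS; case: (a) (b) (d) => [] [] []; clear; lia.
have finish : near_star [set: G] true (1 < k) (2 < k) (k - 3) (n - 4 - (k - 3)) ->
    giso G (Qprime n k).
  by move/labelled_giso; apply; exact: Qprime_near_star.
case=> [[_ /and3P[ea /eqP eb /eqP ed]] | [N3 tie]].
  apply: finish; rewrite -eb -ed; move: lX; rewrite ea.
  have -> : k - 3 = l.
    by move: kE; rewrite ea eb ed; case: (k) => [|[|[|j]]] /=; clear; lia.
  suff -> : r = n - 4 - l by [].
  by move: card_lr cardS; clear; lia.
(* In a tie the tree is the path on four vertices, whose reversal gives the canonical position of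
   [A]. *)
have n5 : n = 5 by move: N3 card_lr cardS; clear; lia.
case: tie => -[ea eb ed el]; move: lX; rewrite ?(negPf ea) ?ea eb (negPf ed) el.
  have -> : r = 1 by move: N3 el; clear; lia.
  move/near_star_tie1=> lX; apply: finish.
  by rewrite kE (negPf ea) eb (negPf ed) el n5.
have -> : r = 0 by move: N3 el; clear; lia.
move/near_star_tie3=> lX; apply: finish.
by rewrite kE ea eb (negPf ed) el n5.
Qed.

End Comparison.

Theorem theorem3p2 (R : realType) (n k : nat) (G : sgraph)
    (hn : 5 <= n) (hk : 1 <= k <= n - 1)
    (hG : quasi_tree_class n k G) (hQ : ~ giso G (Qgraph n k)) :
  (k \in [:: 1; 2; 3; n - 1] ->
     (SO R G <= phi' R n k)%R
     /\ (SO R G = phi' R n k <-> giso G (Qprime n k)))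
  /\
  (4 <= k <= n - 2 -> 23 <= n ->
     (SO R G <= phi_star R n k)%R
     /\ (SO R G = phi_star R n k <-> giso G (Qstar n k))).
Proof.
have k0 : 0 < k by case/andP: hk.
have k_n : 0 < k < n by move: hk hn; clear; lia.
have n4 : (n - 2)%:R%R = (n%:R - 2)%R :> R by rewrite natrB // ltnW // ltnW // ltnW.
split=> [k_in | k_mid n23].
  have toQprime : giso G (Qprime n k) -> SO R G = phi' R n k.
    by move/(SO_giso R) ->; exact: SO_Qprime.
  have [[isoS k_lt] | [le_SO eq_SO]] := quasi_tree_dichotomy R hn k0 hG hQ; last first.
    by split=> //; split.
  have eq_SO : SO R G = phi_star R n k by rewrite (SO_giso R isoS) SO_Qstar.
  case: (eqVneq k 1) isoS eq_SO toQprime => [-> | k1] isoS eq_SO toQprime.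
    have eq' : SO R G = phi' R n 1 by rewrite eq_SO phi_starE phiS1 phi'E.
    by rewrite eq'; split=> //; split=> // _; rewrite /Qprime Sprime_Qstar.
  (* [k_lt] excludes [k = n - 1], so [k] is 2 or 3. *)
  have lt_SO : (SO R G < phi' R n k)%R.
    rewrite eq_SO phi_starE phi'E //; apply: phiS_lt.
      by rewrite -n4 ler_nat; move: hn; clear; lia.
    by move: k_in k1 k0 k_lt; rewrite !inE; clear; lia.
  split; first exact: ltW.
  by split=> [e | /toQprime e]; rewrite e ltxx in lt_SO.
have k_lt : k < n.-1 by move: k_mid n23; clear; lia.
have toQstar : giso G (Qstar n k) -> SO R G = phi_star R n k.
  by move/(SO_giso R) ->; exact: SO_Qstar.
have [[isoS _] | [le_SO _]] := quasi_tree_dichotomy R hn k0 hG hQ.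
  by rewrite (toQstar isoS); split.
have lt_SO : (SO R G < phi_star R n k)%R.
  apply: le_lt_trans le_SO _; rewrite phi_starE phi'E //.
  have := @phi3_lt_phiS R (n%:R - 2)%R k; rewrite -n4 !ler_nat.
  by case: (k) k_mid => [|[|[|j]]] // k_mid; apply; move: k_mid n23; clear; lia.
split; first exact: ltW.
by split=> [e | /toQstar e]; rewrite e ltxx in lt_SO.
Qed.
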